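(* Let $\ell\geq5$ be an integer and let $G$ be a graph with girth $2\ell+1$ and no odd hole of length at least $2\ell+3$. If $G$ is $4$-vertex-critical, then $G$ does not contain a balanced $K_4$-subdivision of type $(1,2)$.
   Context: Graphs are finite and simple; for a path $F$, $|F|$ denotes its number of edges. A hole is an induced cycle of length at least four; odd/even according to its length. A graph $G$ is $4$-vertex-critical if its chromatic number is $4$ and $G-v$ has chromatic number at most $3$ for every vertex $v$. For a graph $H$ isomorphic to a subdivision of $K_4$, an arris is a path of $H$ whose ends are degree-3 vertices and which contains exactly two degree-3 vertices of $H$; the face cycles are the four cycles each formed by three arrises joining three of the four degree-3 vertices. $G$ contains a balanced $K_4$-subdivision of type $(1,2)$ if $G$ has an induced subgraph $H$ isomorphic to a subdivision of $K_4$ whose degree-3 vertices and arrises can be labelled $u_1,u_2,u_3,u_4$ and $P_1$ ($u_1u_2$), $P_2$ ($u_3u_4$), $Q_1$ ($u_2u_3$), $Q_2$ ($u_1u_4$), $L_1$ ($u_1u_3$), $L_2$ ($u_2u_4$) (where the parenthesis gives the ends) such that $P_1\cup Q_1\cup L_1$ and $P_1\cup Q_2\cup L_2$ are odd holes of $G$, $P_2\cup Q_1\cup L_2$ and $P_2\cup Q_2\cup L_1$ are even holes of $G$, $|Q_1|=1$ and $|L_2|>1$. *)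

(* Defs.v *)
From mathcomp Require Import all_boot.

Set Implicit Arguments.
Unset Strict Implicit.
Unset Printing Implicit Defensive.

Record sgraph := SGraph {
  vertex :> finType;
  adj : rel vertex;
  adj_sym : symmetric adj;
  adj_irrefl : irreflexive adj }.

Section Basics.
Variable G : sgraph.

Definition degree (x : G) : nat := #|[set y | adj x y]|.

Definition colorable (k : nat) : bool :=
  [exists f : {ffun G -> 'I_k},
    [forall x, forall y, adj x y ==> (f x != f y)]].

Lemma colorable_ex : exists k, colorable k.
Proof.
exists #|G|; apply/existsP; exists [ffun x => enum_rank x].
apply/forallP=> x; apply/forallP=> y; apply/implyP=> exy; rewrite !ffunE.
apply/negP=> /eqP/enum_rank_inj xy.
by rewrite xy adj_irrefl in exy.
Qed.

Definition chromatic_number : nat := ex_minn colorable_ex.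

(* A cycle is the list of its vertices in cyclic order, the last one being
   adjacent to the first; its length is its [size]. *)
Definition is_cycle (c : seq G) : bool :=
  [&& 3 <= size c, uniq c & cycle (@adj G) c].

Definition has_girth (g : nat) : Prop :=
  (exists2 c, is_cycle c & size c = g) /\
  (forall c, is_cycle c -> g <= size c).

Definition is_hole (c : seq G) : Prop :=
  [/\ is_cycle c, 4 <= size c &
      {in c &, forall x y, adj x y -> y = next c x \/ x = next c y}].

Definition odd_hole (c : seq G) : Prop := is_hole c /\ odd (size c).
Definition even_hole (c : seq G) : Prop := is_hole c /\ ~~ odd (size c).

(* A path is the list of all its vertices, both ends included. *)
Definition is_path (u v : G) (p : seq G) : Prop :=
  exists q, [/\ p = u :: q, path (@adj G) u q, uniq p & last u q = v].

Definition plength (p : seq G) : nat := (size p).-1.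

Definition on_path_edge (p : seq G) (x y : G) : bool :=
  infix [:: x; y] p || infix [:: y; x] p.

(* The list of vertices of the closed walk p, q, r, where p goes from a to b,
   q from b to c, and r from c back to a. *)
Definition close3 (p q r : seq G) : seq G := behead p ++ behead q ++ behead r.

End Basics.

Section Induced.
Variables (G : sgraph) (S : {set G}).

Definition induced_adj : rel {x : G | x \in S} :=
  [rel x y | adj (val x) (val y)].

Lemma induced_sym : symmetric induced_adj.
Proof. by move=> x y; apply: adj_sym. Qed.

Lemma induced_irrefl : irreflexive induced_adj.
Proof. by move=> x; apply: adj_irrefl. Qed.

Definition induced : sgraph := SGraph induced_sym induced_irrefl.

Definition to_ambient (p : seq induced) : seq G :=
  [seq val x | x : {x : G | x \in S} <- p].

End Induced.

Definition vertex_critical4 (G : sgraph) : Prop :=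
  chromatic_number G = 4 /\
  forall v : G, chromatic_number (induced [set~ v]) <= 3.

Section Complete.
Variable n : nat.

Definition complete_adj : rel 'I_n := [rel i j | i != j].

Lemma complete_sym : symmetric complete_adj.
Proof. by move=> i j; rewrite /complete_adj /= eq_sym. Qed.

Lemma complete_irrefl : irreflexive complete_adj.
Proof. by move=> i; rewrite /complete_adj /= eqxx. Qed.

Definition complete : sgraph := SGraph complete_sym complete_irrefl.

End Complete.

(* H is (up to isomorphism) obtained from F by replacing its edges xy by
   internally disjoint paths [p x y] joining the images [b x] and [b y] of
   their ends. *)
Definition is_subdivision (F H : sgraph) : Prop :=
  exists (b : F -> H) (p : F -> F -> seq H),
    [/\ injective b,
        forall x y, adj x y -> is_path (b x) (b y) (p x y)
                               /\ p y x = rev (p x y),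
        forall x y z, adj x y -> b z \in p x y -> z = x \/ z = y,
        forall x y x' y', adj x y -> adj x' y' -> [set x; y] != [set x'; y'] ->
          forall h, h \in p x y -> h \in p x' y' -> exists z, h = b z &
        (forall h : H, (exists z, h = b z)
                       \/ (exists x y, adj x y /\ h \in p x y)) /\
        (forall h k : H, adj h k ->
           exists x y, adj x y /\ on_path_edge (p x y) h k)].

Definition is_arris (H : sgraph) (u v : H) (p : seq H) : Prop :=
  [/\ is_path u v p, degree u = 3, degree v = 3 &
      #|[set x in p | degree x == 3]| = 2].

Definition contains_balanced_K4_subdivision_12 (G : sgraph) : Prop :=
  exists S : {set G},
  let H := induced S in
  is_subdivision (complete 4) H /\
  exists (u1 u2 u3 u4 : H) (P1 P2 Q1 Q2 L1 L2 : seq H),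
    [/\ uniq [:: u1; u2; u3; u4] /\
        [set x : H | degree x == 3] = [set u1; u2; u3; u4],
        [/\ is_arris u1 u2 P1, is_arris u3 u4 P2, is_arris u2 u3 Q1,
            is_arris u1 u4 Q2 & is_arris u1 u3 L1 /\ is_arris u2 u4 L2],
        odd_hole (to_ambient (close3 P1 Q1 (rev L1))) /\
        odd_hole (to_ambient (close3 P1 L2 (rev Q2))),
        even_hole (to_ambient (close3 Q1 P2 (rev L2))) /\
        even_hole (to_ambient (close3 L1 P2 (rev Q2))) &
        plength Q1 = 1 /\ 1 < plength L2].

(* Main.v *)
(* Write a, b, p for the lengths of P1, Q2, P2. Parity forces P1 Q1 P2 Q2 to be
   an odd hole, so a + b + p = 2l, |L1| = 2l - a, |L2| = p + 1 and p >= l.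
   Let z be the middle vertex of P2, with neighbours zm and zp on P2.

   A 4-vertex-critical graph of this kind has no star cutset: give the centre x
   the same colour in 3-colourings of both sides; the vertices of the other two
   colours contain an odd hole, but a (2l+1)-cycle meets the neighbourhood of x
   at most once.

   Let F be the component, in the graph without H, N(zm) and N(zp), of a third
   neighbour of z. A shortest path through F from z to another vertex of H
   closes up with the induced paths of H to holes, whose lengths and parities
   are contradictory; so F attaches to H only at z. If F had outer neighbours
   both in N(zm) and in N(zp), then a path through F from zm to zp would replace
   z both in the odd hole P1 Q1 P2 Q2 and in the even hole P2 Q1 L2, one of the
   results being an odd hole that is too long. Hence F is cut off by a subset
   of N[zm] or of N[zp], a star cutset. *)
Require Import Defs.
From mathcomp Require Import all_boot perm zify.

Set Implicit Arguments.
Unset Strict Implicit.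
Unset Printing Implicit Defensive.

(** A jump is contradictory because its attachment is reached in H by several routes. Two routes
    that differ by the two ways round an odd cycle close up to holes of opposite parities; the odd
    one has length exactly 2l+1, and all have length at least 2l+1. The resulting conditions, linear
    in the lengths of the pieces, are inconsistent. The obstacle is chords. The last vertex of a
    jump may have several neighbours in H, and a route must avoid all of them but its end. Each of
    the (2l+1)-cycles P1 Q1 L1, P1 L2 Q2 and P1 Q1 P2 Q2 contains at most one of them, so there are
    at most three. Also, an arris that is a single edge, as Q1 always is, is a chord of every route
    that meets both its ends without using it. Paths of H are therefore handled as lists of labelled
    segments, for which being induced is a computable condition. N(zm) and N(zp) are removed so that
    jumps from z cannot attach at zm or zp. In the star cutset lemma the two colourings may disagree
    on the neighbourhood of x, so only the colour class of x is glued together. *)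

(** * Colourings of 4-vertex-critical graphs *)

Lemma chromatic_number_colorable (G : sgraph) k :
  chromatic_number G <= k -> colorable G k.
Proof.
rewrite /chromatic_number; case: ex_minnP => m /existsP[f fP] _ le_mk.
apply/existsP; exists [ffun x => widen_ord le_mk (f x)].
apply/forallP=> x; apply/forallP=> y; apply/implyP=> exy; rewrite !ffunE.
have := implyP (forallP (forallP fP x) y) exy.
by apply: contra => /eqP/(congr1 val)/= fxy; apply/eqP/val_inj.
Qed.

Lemma critical_not_3colored (G : sgraph) (f : G -> 'I_3) :
  vertex_critical4 G -> ~ (forall x y, adj x y -> f x != f y).
Proof.
case=> chi4 _ fP; suff : chromatic_number G <= 3 by rewrite chi4.
rewrite /chromatic_number; case: ex_minnP => m _; apply.
apply/existsP; exists [ffun x => f x].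
by apply/forallP=> x; apply/forallP=> y; apply/implyP=> exy; rewrite !ffunE fP.
Qed.

Lemma critical_3colored_off (G : sgraph) (v : G) :
  vertex_critical4 G ->
  exists f : G -> 'I_3,
    forall x y, x != v -> y != v -> adj x y -> f x != f y.
Proof.
case=> _ /(_ v)/chromatic_number_colorable/existsP[f fP].
(* The default [ord0] is taken only at [v], which the claim leaves out. *)
exists (fun x => if insub x is Some x' then f x' else ord0) => x y xv yv exy.
have xS : x \in [set~ v] by rewrite !inE.
have yS : y \in [set~ v] by rewrite !inE.
rewrite (insubT (fun x => x \in [set~ v]) xS).
rewrite (insubT (fun x => x \in [set~ v]) yS).
by apply: (implyP (forallP (forallP fP _) _)).
Qed.

(** Were [u] and [v] the only possible neighbours of [z], a 3-colouring of the graph without [z]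
    would leave a colour free for [z]. *)
Lemma critical_third_neighbour (G : sgraph) (z u v : G) :
  vertex_critical4 G -> exists w, [/\ adj z w, w != u & w != v].
Proof.
move=> crit; have [f fP] := critical_3colored_off z crit.
have [/existsP[w /and3P[]]|/existsPn no_w] :=
  boolP [exists w, [&& adj z w, w != u & w != v]]; first by exists w.
have [c /andP[cu cv]] : exists c : 'I_3, (c != f u) && (c != f v).
  apply/existsP; apply: contraT; rewrite negb_exists => /forallP cP.
  have /subset_leq_card : [set: 'I_3] \subset [set f u; f v].
    apply/subsetP=> c _; rewrite !inE; move: (cP c).
    by rewrite negb_and !negbK.
  by rewrite cardsT card_ord cards2; case: (f u != f v).
case: (@critical_not_3colored G (fun x => if x == z then c else f x) crit).
have zw x : adj z x -> c != f x.
  move=> ezx; have := no_w x; rewrite ezx /= negb_and !negbK.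
  by case/orP=> /eqP->.
move=> x y exy; case: (eqVneq x z) => [xz|xz]; case: (eqVneq y z) => [yz|yz].
- by rewrite xz yz adj_irrefl in exy.
- by rewrite zw // -xz.
- by rewrite eq_sym zw // -yz adj_sym.
- exact: fP.
Qed.

(** * Bipartiteness, odd closed walks and chordless odd cycles *)

Lemma mem_split (G : sgraph) (x : G) (s : seq G) :
  x \in s -> exists s1 s2 : seq G, s = s1 ++ x :: s2.
Proof. by case/splitPr=> s1 s2; exists s1, s2. Qed.

Section ClosedWalks.
Variables (G : sgraph) (T : pred G).

Definition chordless (c : seq G) : Prop :=
  {in c &, forall x y, adj x y -> y = next c x \/ x = next c y}.

(* A closed walk of minimal odd length repeats no vertex and has no chord,
   since either defect splits it into two closed walks one of which is odd. *)
Lemma odd_closed_walk_chordless (c : seq G) :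
    cycle (@adj G) c -> odd (size c) -> all T c ->
  exists2 c', is_cycle c' && odd (size c') & chordless c' /\ all T c'.
Proof.
have [n] := ubnP (size c); elim: n c => // n IHn c le_cn cyc oddc Tc.
have short (d : seq G) : size d < size c -> cycle (@adj G) d -> all T d ->
    odd (size d) ->
  exists2 c', is_cycle c' && odd (size c') & chordless c' /\ all T c'.
  by move=> ltdc cycd Td oddd; apply: (IHn d) => //; apply: leq_trans ltdc _.
have rotP x : x \in c -> exists i c', [/\ rot i c = x :: c',
    cycle (@adj G) (x :: c'), all T (x :: c') & (size c').+1 = size c].
  case/rot_to=> i c' ri; exists i, c'; split=> //.
  - by rewrite -ri rot_cycle.
  - by rewrite -ri; apply/allP=> y; rewrite mem_rot => /(allP Tc).
  - by rewrite -[LHS]/(size (x :: c')) -ri size_rot.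
have [uc|nuc] := boolP (uniq c); last first.
  have [x xc nx] : exists2 x, x \in c & count_mem x c > 1.
    elim: (c) nuc => //= y s IHs.
    rewrite negb_and negbK => /orP[ys|nus].
      by exists y; rewrite ?inE ?eqxx //= ltnS -has_count has_pred1.
    have [x xs nx] := IHs nus; exists x; first by rewrite inE xs orbT.
    by apply: leq_trans nx _; apply: leq_addl.
  have [i [c' [ri cyc' Tc' sc']]] := rotP x xc.
  have : x \in c'.
    have : count_mem x (rot i c) > 1 by rewrite (seq.permP (_ : perm_eq _ c)) // perm_rot.
    by rewrite ri /= eqxx -has_pred1 has_count.
  case/mem_split=> s1 [s2 c'E]; rewrite {c'}c'E in ri cyc' Tc' sc'.
  have [c1 c2] : cycle (@adj G) (x :: s1) /\ cycle (@adj G) (x :: s2).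
    move: cyc' => /=; rewrite rcons_cat cat_path /= => /and3P[p1 e1 p2].
    by split=> //; rewrite rcons_path p1 e1.
  have [t1 t2] : all T (x :: s1) /\ all T (x :: s2).
    by move: Tc'; rewrite /= all_cat /= => /and4P[-> -> _ ->].
  move: sc'; rewrite size_cat /= => sc'.
  have [o1|o1] := boolP (odd (size (x :: s1))).
    by apply: short c1 t1 o1; rewrite /=; clear -sc'; lia.
  apply: short c2 t2 _; rewrite /=; first by clear -sc'; lia.
  by move: o1 oddc; rewrite -sc' /=; clear; lia.
have [/forall_inP chord|] := boolP [forall x in c, [forall y in c,
    adj x y ==> ((y == next c x) || (x == next c y))]].
  exists c; last first.
    split=> // x y xc yc exy.
    have /forallP/(_ y) := chord x xc; rewrite yc exy /=.
    by case/orP=> /eqP; [left|right].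
  rewrite oddc andbT /is_cycle uc cyc !andbT.
  case: (c) oddc cyc => [|x [|y [|? ?]]] //=.
  by rewrite andbT adj_irrefl.
case/forall_inPn=> x xc /forall_inPn[y yc]; rewrite negb_imply negb_or.
case/and3P=> exy ny nx.
have [i [c' [ri cyc' Tc' sc']]] := rotP x xc.
have : y \in c'.
  move: yc; rewrite -(mem_rot i) ri inE => /orP[/eqP yx|//].
  by rewrite yx adj_irrefl in exy.
case/mem_split=> s1 [s2 c'E]; rewrite {c'}c'E in ri cyc' Tc' sc'.
have [c1 c2] : cycle (@adj G) (x :: rcons s1 y) /\ cycle (@adj G) (y :: rcons s2 x).
  move: cyc' => /=; rewrite rcons_cat cat_path /= => /and3P[p1 e1 p2].
  by split; rewrite rcons_path ?last_rcons ?p2 ?exy //= rcons_path p1 e1 adj_sym exy.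
have [t1 t2] : all T (x :: rcons s1 y) /\ all T (y :: rcons s2 x).
  by move: Tc'; rewrite /= !all_rcons all_cat /= => /and4P[-> -> -> ->].
have nr : next c =1 next (x :: s1 ++ y :: s2) by move=> v; rewrite -ri next_rot.
(* As [x] and [y] are not consecutive on [c], both arcs have interior vertices, so each of the two
   walks closed by the chord is shorter than [c]. Their lengths add up to [size c + 2], hence one of
   them is odd. *)
have s1_gt0 : 0 < size s1.
  by case: s1 nr {ri cyc' Tc' sc' c1 c2 t1 t2} => // nr; rewrite nr /= eqxx eqxx in ny.
have s2_gt0 : 0 < size s2.
  case: s2 nr ri {cyc' Tc' sc' c1 c2 t1 t2} => // nr ri; move: nx.
  have ur : uniq (x :: s1 ++ [:: y]) by rewrite -ri rot_uniq.
  rewrite nr -(next_rot (size (x :: s1)) ur) -cat_cons rot_size_cat /=.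
  by rewrite eqxx eqxx.
move: sc'; rewrite size_cat /= => sc'.
have [o1|o1] := boolP (odd (size (x :: rcons s1 y))).
  by apply: short c1 t1 o1; rewrite /= size_rcons; clear -sc' s2_gt0; lia.
apply: short c2 t2 _; rewrite /= size_rcons; first by clear -sc' s1_gt0; lia.
by move: o1 oddc; rewrite -sc' /= size_rcons; clear; lia.
Qed.

(** The relation [e2] is the bipartite double cover of the subgraph induced on [T]. A path in it
    from [(x, false)] to [(x, true)] projects to an odd closed walk. If there is none, each
    component of the cover contains at most one of the two copies of a vertex, and lying in the
    component of a chosen root is a 2-colouring. *)
Lemma bipartite_or_odd_closed_walk :
  (exists g : G -> bool, forall x y, T x -> T y -> adj x y -> g x != g y) \/
  (exists c, [/\ cycle (@adj G) c, odd (size c) & all T c]).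
Proof.
pose e1 := [rel x y : G | [&& adj x y, T x & T y]].
pose e2 := [rel u v : G * bool | e1 u.1 v.1 && (u.2 != v.2)].
have e1s : symmetric e1 by move=> x y /=; rewrite adj_sym (andbC (T x)).
have e2s : symmetric e2 by move=> u v; rewrite /= adj_sym (andbC (T u.1)) eq_sym.
have c1s := sym_connect_sym e1s; have c2s := sym_connect_sym e2s.
have flip x y b c : connect e2 (x, b) (y, c) -> connect e2 (x, ~~ b) (y, ~~ c).
  case/connectP=> p pP lp; apply/connectP.
  pose f (v : G * bool) := (v.1, ~~ v.2); rewrite -[(x, ~~ b)]/(f (x, b)).
  exists (map f p); last by rewrite last_map -lp.
  elim: p (x, b) pP {lp} => //= v p IHp u /andP[/andP[-> uv] /IHp->].
  by rewrite andbT /=; case: (u.2) (v.2) uv => [] [].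
have [/existsP[x xP]|/existsPn nox] := boolP [exists x, connect e2 (x, false) (x, true)].
  right; case/connectP: xP => p pP lp; exists [seq v.1 | v <- p].
  have [pa pb pc] : [/\ path (@adj G) x [seq v.1 | v <- p],
      all T [seq v.1 | v <- p] &
      (last (x, false) p).2 = odd (size p)].
    rewrite -[x]/((x, false).1) -[odd _]addFb -[X in X (+) _]/((x, false).2).
    elim: p (x, false) pP {lp} => /= [|v p IHp] u; first by rewrite addbF.
    case/andP=> /andP[/and3P[-> _ ->] uv] /IHp[-> -> ->]; split=> //.
    by move: uv; case: (u.2) (v.2) (odd _) => [] [] [].
  rewrite size_map pb -pc -lp; split=> //.
  case: p lp pa {pb pc pP} => //= v p lp /andP[xv pv].
  by rewrite rcons_path pv last_map -lp.
left; exists (fun x => connect e2 (root e1 x, false) (x, false)).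
have lift x y b : connect e1 x y -> exists c, connect e2 (x, b) (y, c).
  case/connectP=> p pP ->; elim: p x b pP => [|v p IHp] x b /=; first by exists b.
  case/andP=> xv /(IHp v (~~ b))[c cP]; exists c.
  by apply: connect_trans cP; apply: connect1; rewrite /= xv; case: b.
move=> x y Tx Ty exy.
have e1xy : e1 x y by rewrite /= exy Tx.
have rxy : root e1 y = root e1 x by apply/esym/(rootP c1s); apply: connect1.
have step b : connect e2 (x, b) (y, ~~ b).
  by apply: connect1; rewrite /= exy Tx Ty; case: b.
rewrite rxy; apply/eqP=> same.
have [c cP] : exists c, connect e2 (root e1 x, false) (x, c).
  by apply: lift; rewrite c1s connect_root.
have nboth v b : connect e2 (root e1 x, false) (v, b) ->
    connect e2 (root e1 x, false) (v, ~~ b) -> False.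
  move=> h1 h2; have := nox (root e1 x); rewrite (connect_trans h1) //.
  have /flip := h2; rewrite negbK /= => h3; rewrite c2s //.
case: c cP same => cP.
  have yP := connect_trans cP (step _); rewrite yP.
  by move=> same; apply: nboth cP _; rewrite same.
rewrite cP => /esym same; have yP := connect_trans cP (step _).
exact: nboth yP same.
Qed.

End ClosedWalks.

(** * Induced paths *)

Section InducedPaths.
Variable G : sgraph.
Implicit Types (s c K W L : seq G) (x y z : G).

Definition induced_path s : Prop :=
  [/\ uniq s, sorted (@adj G) s & {in s &, forall x y, adj x y -> on_path_edge s x y}].

Lemma on_path_edge_rev s x y : on_path_edge (rev s) x y = on_path_edge s x y.
Proof. by rewrite /on_path_edge -!infix_revLR /rev /= orbC. Qed.

Lemma on_path_edge_sym s x y : on_path_edge s x y = on_path_edge s y x.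
Proof. exact: orbC. Qed.

Lemma on_path_edge_infix s1 s2 x y :
  infix s1 s2 -> on_path_edge s1 x y -> on_path_edge s2 x y.
Proof.
move=> s12 /orP[] e; apply/orP; [left|right]; exact: infix_trans e s12.
Qed.

Lemma sorted_rev s : sorted (@adj G) (rev s) = sorted (@adj G) s.
Proof. by rewrite rev_sorted; apply: eq_sorted => x y; rewrite adj_sym. Qed.

Lemma induced_path_rev s : induced_path s -> induced_path (rev s).
Proof.
case=> us ss es; split; rewrite ?rev_uniq ?sorted_rev // => x y.
by rewrite !mem_rev on_path_edge_rev; apply: es.
Qed.

(** Repeating the first vertex at the end makes the closing edge an infix like any other, so that
    edges of cycles can be found as edges of paths. *)
Lemma infix_next h c x y :
  uniq (h :: c) -> infix [:: x; y] (rcons (h :: c) h) -> y = next (h :: c) x.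
Proof.
move=> uc /infixP[s1 [s2 cE]]; rewrite rcons_cons in cE.
case/lastP: s2 cE => [|s2 v] cE.
  have /rcons_inj[cE1 yh] : rcons (h :: c) h = rcons (rcons s1 x) y.
    by rewrite rcons_cons cE -!cats1 -catA.
  rewrite -(next_rot (size s1) uc) cE1 -cats1 rot_size_cat /=; rewrite -yh.
  by case: s1 cE1 {cE} => [|v s1] [-> _] /=; rewrite eqxx.
have /rcons_inj[cE1 _] : rcons (h :: c) h = rcons (s1 ++ x :: y :: s2) v.
  by rewrite rcons_cons cE -!cats1 -!catA.
rewrite -(next_rot (size s1) uc) cE1 rot_size_cat /=.
by rewrite eqxx.
Qed.

Lemma chordless_on_path_edge h c :
    uniq (h :: c) ->
    {in h :: c &, forall x y, adj x y -> on_path_edge (rcons (h :: c) h) x y} ->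
  chordless (h :: c).
Proof.
move=> uc ec x y xc yc exy; case/orP: (ec x y xc yc exy) => /infix_next.
  by move/(_ uc); left.
by move/(_ uc); right.
Qed.

Lemma infix2_cat s1 s2 x y : infix [:: x; y] (rcons s1 x ++ y :: s2).
Proof. by rewrite cat_rcons; apply/infixP; exists s1, s2. Qed.

(** The only edges between the two paths are those that close the cycle. Either path may be a single
    vertex, which is then both its head and its last vertex; the bound on the total size excludes
    degenerate cycles. *)
Lemma hole_join x0 K W :
    induced_path K -> induced_path W -> 0 < size K -> 0 < size W ->
    3 <= size K + size W -> {in K, forall x, x \notin W} ->
    adj (last x0 K) (head x0 W) -> adj (last x0 W) (head x0 K) ->
    {in K & W, forall x y, adj x y ->
      (x = last x0 K /\ y = head x0 W) \/ (x = head x0 K /\ y = last x0 W)} ->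
  is_cycle (K ++ W) /\ chordless (K ++ W).
Proof.
case: K => // h K; case: W => // h' W [uK sK eK] [uW sW eW] _ _ sz dis e1 e2 cross.
have uKW : uniq ((h :: K) ++ h' :: W).
  rewrite cat_uniq uK uW andbT; apply/hasPn=> y yW; apply/negP=> /dis.
  by rewrite yW.
have cl : infix (h :: K) (rcons ((h :: K) ++ h' :: W) h).
  by rewrite rcons_cat prefix_infix.
have cl' : infix (h' :: W) (rcons ((h :: K) ++ h' :: W) h).
  by rewrite rcons_cat -cats1 infix_infix.
have crossE x y : x \in h :: K -> y \in h' :: W -> adj x y ->
    on_path_edge (rcons ((h :: K) ++ h' :: W) h) x y.
  move=> xK yW exy; case: (cross x y xK yW exy) => [] [xE yE].
    rewrite xE yE; apply/orP; left; rewrite rcons_cat rcons_cons (lastI h K).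
    rewrite last_rcons; exact: infix2_cat.
  rewrite xE yE; apply/orP; right.
  rewrite [h' :: W]lastI last_rcons -rcons_cat -(cats1 _ h); exact: infix2_cat.
split.
  rewrite /is_cycle size_cat sz uKW /= rcons_cat cat_path /=.
  by move: sK sW e1 e2 => /= -> pW ->; rewrite rcons_path pW.
apply: chordless_on_path_edge => // x y; rewrite -cat_cons !mem_cat.
case/orP=> xi /orP[] yi exy.
- by apply: on_path_edge_infix cl _; apply: eK.
- exact: crossE.
- by rewrite on_path_edge_sym crossE // adj_sym.
- by apply: on_path_edge_infix cl' _; apply: eW.
Qed.

(** A walk in [D] from [A] to [B] can be shortened as long as it repeats a vertex, has a chord, or
    meets [A] or [B] elsewhere than at the corresponding end; a shortest one has all the required
    properties. *)
Lemma shortest_link (D A B : pred G) x0 L :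
    0 < size L -> sorted (@adj G) L -> all D L -> A (head x0 L) -> B (last x0 L) ->
  exists W, [/\ 0 < size W, induced_path W, all D W,
    A (head x0 W) /\ {in W, forall x, A x -> x = head x0 W} &
    B (last x0 W) /\ {in W, forall x, B x -> x = last x0 W}].
Proof.
have [n] := ubnP (size L); elim: n L => // n IHn L leLn L0 sL DL AL BL.
(* One reduction serves repeated vertices and chords: the part between [x] and [y] is cut out,
   together with one of them if they coincide. *)
have shortcut s1 x s2 y s3 : L = s1 ++ x :: s2 ++ y :: s3 ->
    (x == y) || (adj x y && (0 < size s2)) ->
  exists W, [/\ 0 < size W, induced_path W, all D W,
    A (head x0 W) /\ {in W, forall x, A x -> x = head x0 W} &
    B (last x0 W) /\ {in W, forall x, B x -> x = last x0 W}].
  move=> LE.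
  have hE t : head x0 L = head x0 (s1 ++ x :: t) by rewrite LE; case: (s1).
  have lE t : last x0 L = last x0 (t ++ y :: s3).
    by rewrite LE last_cat /= last_cat /= last_cat.
  have sx : sorted (@adj G) (rcons s1 x).
    by move: sL; rewrite LE -cat_rcons => /cat_sorted2[].
  have sy : path (@adj G) y s3.
    by move: sL; rewrite LE -cat_cons catA => /cat_sorted2[_].
  move: (DL); rewrite {1}LE all_cat /= all_cat /= => /and5P[D1 Dx D2 Dy D3].
  move: leLn; rewrite LE !size_cat /= size_cat /= => leLn.
  case/orP=> [/eqP xy|/andP[exy s20]].
    apply: (IHn (s1 ++ y :: s3)).
    - by rewrite size_cat /=; clear -leLn; lia.
    - by rewrite size_cat /= addnS.
    - rewrite -cat_rcons -xy; case: (s1) sx => [|v t] /=; first by rewrite xy.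
      by rewrite cat_path last_rcons xy => ->.
    - by rewrite all_cat D1 /= Dy.
    - by rewrite -xy -hE.
    - by rewrite -lE.
  apply: (IHn (s1 ++ x :: y :: s3)).
  - by rewrite size_cat /=; clear -leLn s20; lia.
  - by rewrite size_cat /= addnS.
  - rewrite -cat_rcons; case: (s1) sx => [|v t] /=; first by rewrite exy.
    by rewrite cat_path last_rcons /= exy => ->.
  - by rewrite all_cat D1 /= Dx Dy.
  - by rewrite -hE.
  - by rewrite -[_ :: _ :: _]cat1s catA -lE.
have [uL|nuL] := boolP (uniq L); last first.
  have [s1 [x [s2 [s3 LE]]]] : exists s1 x s2 s3, L = s1 ++ x :: s2 ++ x :: s3.
    elim: (L) nuL => //= v L' IHL; rewrite negb_and negbK => /orP[vL|nuL].
      by have [s2 [s3 ->]] := mem_split vL; exists [::], v, s2, s3.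
    by have [s1 [x [s2 [s3 ->]]]] := IHL nuL; exists (v :: s1), x, s2, s3.
  by apply: (shortcut s1 x s2 x s3) => //; rewrite eqxx.
have [/forall_inP AP|/forall_inPn[x xL]] :=
  boolP [forall x in L, A x ==> (x == head x0 L)]; last first.
  rewrite negb_imply => /andP[Ax xh]; have [s1 [s2 LE]] := mem_split xL.
  have s10 : 0 < size s1 by case: s1 LE => // LE; rewrite LE eqxx in xh.
  apply: (IHn (x :: s2)) => //.
  - by move: leLn; rewrite LE size_cat /=; lia.
  - by move: sL; rewrite LE => /cat_sorted2[].
  - by move: DL; rewrite LE all_cat => /andP[].
  - by move: BL; rewrite LE last_cat.
have [/forall_inP BP|/forall_inPn[x xL]] :=
  boolP [forall x in L, B x ==> (x == last x0 L)]; last first.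
  rewrite negb_imply => /andP[Bx xh]; have [s1 [s2 LE]] := mem_split xL.
  have s20 : 0 < size s2.
    by case: s2 LE => // LE; rewrite LE last_cat eqxx in xh.
  apply: (IHn (rcons s1 x)); rewrite ?size_rcons ?last_rcons //.
  - by move: leLn; rewrite LE size_cat /=; lia.
  - by move: sL; rewrite LE -cat_rcons => /cat_sorted2[].
  - by move: DL; rewrite LE -cat_rcons all_cat => /andP[].
  - by move: AL; rewrite LE; case: (s1).
have [/forall_inP eP|/forall_inPn[x xL /forall_inPn[y yL]]] :=
  boolP [forall x in L, [forall y in L, adj x y ==> on_path_edge L x y]].
  exists L; split=> //.
  - split=> // x y xL yL exy.
    by have /forall_inP/(_ y yL)/implyP := eP x xL; apply.
  - by split=> // x /AP/implyP H /H/eqP.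
  - by split=> // x /BP/implyP H /H/eqP.
rewrite negb_imply => /andP[exy]; have [s1 [r LE]] := mem_split xL.
move: yL; rewrite LE mem_cat inE => /or3P[ys|/eqP yx|yr].
- have [t1 [t2 s1E]] := mem_split ys; rewrite s1E -catA /= => ne.
  apply: (shortcut t1 y t2 x r); first by rewrite LE s1E -catA.
  rewrite adj_sym exy orbC /=; case: t2 ne {s1E} => //=.
  by rewrite /on_path_edge -[y :: x :: r]/([:: y; x] ++ r) infix_infix orbT.
- by rewrite yx adj_irrefl in exy.
have [t1 [t2 rE]] := mem_split yr; rewrite rE => ne.
apply: (shortcut s1 x t1 y t2); first by rewrite LE rE.
rewrite exy orbC /=; case: t1 ne {rE} => //=.
by rewrite /on_path_edge -[x :: y :: t2]/([:: x; y] ++ t2) infix_infix.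
Qed.

End InducedPaths.

(** * Star cutsets *)

Lemma odd_cycle_not_bicolored (T : eqType) (g : T -> bool) (c : seq T) :
  cycle (fun x y => g x != g y) c -> ~~ odd (size c).
Proof.
case: c => // x c; rewrite -[size _]/(size c).+1 -(size_rcons c x) [cycle _ _]/=.
have : last x (rcons c x) = x by rewrite last_rcons.
move=> /(congr1 g); move: (rcons c x) => {}c.
have E : path (fun x y => g x != g y) x c -> g (last x c) = g x (+) odd (size c).
  elim: c x => /= [|y c IHc] x; first by rewrite addbF.
  by case/andP=> xy /IHc->; move: xy; case: (g x) (g y) => [] []; case: odd.
by move=> lc /E; rewrite lc; case: (g x); case: odd.
Qed.

Lemma two_colors (a b c d : 'I_3) :
  d != c -> a != c -> b != c -> a != b -> (a == d) != (b == d).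
Proof.
by case: a b c d => [[|[|[|//]]] ?] [[|[|[|//]]] ?] [[|[|[|//]]] ?] [[|[|[|//]]] ?].
Qed.

Lemma other_colors (c : 'I_3) :
  exists h : bool -> 'I_3, h true != h false /\ forall b, h b != c.
Proof.
exists (fun b => if b then ordS c else ordS (ordS c)).
by split=> [|[]]; case: c => [[|[|[|//]]] ?].
Qed.

Section NoLongOddHole.
Variables (l : nat) (G : sgraph).
Hypothesis hl : 2 <= l.
Hypothesis girth_ge : forall c : seq G, is_cycle c -> 2 * l + 1 <= size c.
Hypothesis hodd : forall c : seq G, odd_hole c -> ~~ (2 * l + 3 <= size c).

Lemma odd_hole_size (c : seq G) :
  is_cycle c -> chordless c -> odd (size c) -> size c = 2 * l + 1.
Proof.
move=> cyc ch oc; have ge := girth_ge cyc.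
suff /hodd : odd_hole c by clear -ge oc; lia.
by split=> //; split=> //; clear -hl ge; lia.
Qed.

(** Two neighbours of [x] split [c] into two arcs, each of which closes with [x] to a cycle. The two
    lengths add up to [2 * l + 5], which is less than twice the girth bound as [l >= 2]. *)
Lemma one_neighbour (c : seq G) x n n' :
    is_cycle c -> size c = 2 * l + 1 -> x \notin c -> n \in c -> n' \in c ->
  adj x n -> adj x n' -> n = n'.
Proof.
case/and3P=> _ uc cyc sc xc nc nc' xn xn'; apply/eqP/negPn/negP => nn'.
have [i s ri] := rot_to nc.
have : n' \in s.
  by move: nc'; rewrite -(mem_rot i) ri inE eq_sym (negbTE nn').
case/mem_split=> s1 [s2 sE]; rewrite {s}sE in ri.
move: uc cyc xc sc; rewrite -(rot_uniq i) -(rot_cycle i) -(mem_rot i) -(size_rot i).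
rewrite ri => uc cyc xc sc.
have /girth_ge : is_cycle (x :: n :: rcons s1 n').
  apply/and3P; split; first by rewrite /= size_rcons.
    rewrite -cat_rcons -cat_cons in uc xc.
    move: uc; rewrite cat_uniq => /andP[u1 _]; rewrite cons_uniq u1 andbT.
    by move: xc; rewrite mem_cat negb_or => /andP[].
  rewrite /= xn rcons_path last_rcons adj_sym xn' andbT.
  by move: cyc; rewrite /= rcons_cat cat_path /= => /and3P[p1 e1 _]; rewrite rcons_path p1.
have /girth_ge : is_cycle (x :: n' :: rcons s2 n).
  apply/and3P; split; first by rewrite /= size_rcons.
    have pe : perm_eq (n' :: rcons s2 n) (n :: n' :: s2).
      by rewrite -rcons_cons perm_rcons.
    rewrite cons_uniq (perm_uniq pe) (perm_mem pe).
    have sub : subseq (n :: n' :: s2) (n :: s1 ++ n' :: s2).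
      by rewrite /= eqxx suffix_subseq.
    by rewrite (subseq_uniq sub uc) andbT; apply: contra xc; apply: mem_subseq.
  rewrite /= xn' rcons_path last_rcons adj_sym xn andbT.
  by move: cyc; rewrite /= rcons_cat cat_path /= => /and3P[].
by move: sc; rewrite /= !size_rcons size_cat /=; clear -hl; lia.
Qed.

(* Colour both sides of the star with the centre x getting the same colour c.
   The vertices of the other two colours then contain an odd hole, which meets
   the neighbourhood of x at most once and hence lies on one side. *)
Lemma no_star_cutset (F : pred G) (x f0 r0 : G) :
    vertex_critical4 G -> F f0 -> ~~ F r0 -> r0 != x -> ~~ adj x r0 ->
    (forall v, F v -> (v != x) && ~~ adj x v) ->
    (forall u v, F u -> adj u v -> [|| F v, v == x | adj x v]) ->
  False.
Proof.
move=> crit Ff0 nFr0 r0x xr0 FX sep.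
have [f1' f1P'] := critical_3colored_off r0 crit.
have [f2 f2P] := critical_3colored_off f0 crit.
(* The transposition of colours makes [f1] agree with [f2] at the centre [x]. *)
pose c := f2 x; pose f1 v := tperm (f1' x) c (f1' v).
have f1x : f1 x = c by rewrite /f1 tpermL.
have f1P u v : u != r0 -> v != r0 -> adj u v -> f1 u != f1 v.
  by move=> ur vr uv; rewrite (inj_eq perm_inj) f1P'.
have xf0 : x != f0 by case/andP: (FX f0 Ff0); rewrite eq_sym.
have nFx : ~~ F x by apply/negP=> /FX; rewrite eqxx.
have neF v u : F v -> ~~ F u -> v != u by move=> Fv; apply: contraNneq => <-.
have nFl v : adj x v -> ~~ F v by move=> xv; apply/negP=> /FX; rewrite xv andbF.
(* The complement of [T] is the glued colour class [c]. It is independent: an edge leaving [F] ends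
   in a neighbour of [x], and there [f2] differs from its value [c] at [x]. *)
pose T v := if F v then f1 v != c else f2 v != c.
have [h [h12 hc]] := other_colors c.
have [[g gP]|[w [wc wodd wT]]] := bipartite_or_odd_closed_walk T.
  apply: (@critical_not_3colored _ (fun v => if T v then h (g v) else c) crit).
  move=> u v uv; have [Tu|nTu] := boolP (T u); have [Tv|nTv] := boolP (T v).
  - by have := gP u v Tu Tv uv; case: (g u) (g v) => [] [] // _; rewrite // eq_sym.
  - exact: hc.
  - by rewrite eq_sym.
  have cross u' v' : F u' -> ~~ F v' -> f2 v' = c -> adj u' v' -> False.
    move=> Fu nFv f2v e; have := sep _ _ Fu e; rewrite (negbTE nFv) /=.
    case/orP=> [/eqP v'x|xv].
      by case/andP: (FX _ Fu) => _; rewrite adj_sym -v'x e.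
    by have := f2P x v' xf0 _ xv; rewrite f2v eqxx eq_sym neF // => /(_ isT).
  move: nTu nTv; rewrite /T.
  case Fu: (F u); case Fv: (F v) => /negPn/eqP cu /negPn/eqP cv.
  - by have := f1P u v (neF _ _ Fu nFr0) (neF _ _ Fv nFr0) uv; rewrite cu cv eqxx.
  - by case: (cross u v Fu (negbT Fv) cv uv).
  - by case: (cross v u Fv (negbT Fu) cu); rewrite adj_sym.
  - have := f2P u v; rewrite cu cv eqxx => -> //; rewrite eq_sym neF ?Fu ?Fv //.
have [d /andP[dcyc dodd] [dch dT]] := odd_closed_walk_chordless wc wodd wT.
have dsz := odd_hole_size dcyc dch dodd.
have xd : x \notin d.
  by apply/negP=> /(allP dT); rewrite /T (negbTE nFx) eqxx.
have [_ dU cd] := and3P dcyc.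
pose ok v := ~~ adj x v && (v != x).
have sepE u v : ok u -> ok v -> adj u v -> F u = F v.
  case/andP=> xu ux /andP[xv vx] uv; apply/idP/idP=> Fw.
    by have := sep _ _ Fw uv; rewrite (negbTE xv) (negbTE vx) !orbF.
  by have := sep v u Fw; rewrite adj_sym uv (negbTE xu) (negbTE ux) !orbF => ->.
have const y s : path (@adj G) y s -> all ok (y :: s) -> {in y :: s, forall v, F v = F y}.
  elim: s y => [|u s IHs] y /=; first by move=> _ _ v; rewrite inE => /eqP->.
  case/andP=> yu us /and3P[oy ou os] v; rewrite inE => /orP[/eqP->//|vs].
  by rewrite (sepE y u) // (IHs u) //= ou.
have okd v : v \in d -> ~~ adj x v -> ok v.
  by move=> vd xv; rewrite /ok xv; apply: contraNneq xd => <-.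
(* Off its at most one neighbour of [x], the cycle [d] is connected, and no edge between vertices
   outside the closed neighbourhood of [x] crosses the boundary of [F]. A neighbour of [x] is
   outside [F], so only the first alternative has to admit it. *)
have side : {in d, forall v, F v || adj x v} \/ {in d, forall v, ~~ F v}.
  have [/hasP[n nd xn]|/hasPn noleaf] := boolP (has (adj x) d).
    have [i s ri] := rot_to nd.
    have [uns cns] : uniq (n :: s) /\ cycle (@adj G) (n :: s).
      by rewrite -ri rot_uniq rot_cycle.
    have sd v : v \in s -> v \in d by move=> vs; rewrite -(mem_rot i) ri inE vs orbT.
    have oks : all ok s.
      apply/allP=> v vs; apply: okd; first exact: sd.
      apply/negP=> xv; have nv := one_neighbour dcyc dsz xd nd (sd v vs) xn xv.
      by move: uns; rewrite /= nv vs.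
    have dE v : v \in d -> v = n \/ v \in s.
      by rewrite -(mem_rot i) ri inE => /orP[/eqP|]; [left|right].
    case: s {ri uns sd} cns oks dE => [|y s] cns oks dE.
      by right=> v /dE[->|//]; apply: nFl.
    have cst := const y s; case Fy: (F y).
      left=> v /dE[->|vs]; first by rewrite xn orbT.
      rewrite cst ?Fy //; move: cns => /= /andP[_].
      by rewrite rcons_path => /andP[].
    right=> v /dE[->|vs]; first exact: nFl.
    rewrite cst ?Fy //; move: cns => /= /andP[_].
    by rewrite rcons_path => /andP[].
  case: (d) noleaf cd okd => [|y s] noleaf cd' okd'; first by left.
  have cst v : v \in y :: s -> F v = F y.
    apply: const; first by move: cd'; rewrite /= rcons_path => /andP[].
    by apply/allP=> u us; apply: okd' => //; apply: noleaf.
  case Fy: (F y); [left|right] => v vd; by rewrite cst ?Fy.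
(* On its side, [d] is properly coloured by one of the original colourings and avoids [c]: two
   colours on an odd cycle. In the first alternative a neighbour of [x] avoids [c] because [f1] has
   the value [c] at [x]. *)
suff [f [fc fP]] : exists f : G -> 'I_3, {in d, forall v, f v != c} /\
    {in d &, forall u v, adj u v -> f u != f v}.
  have /odd_cycle_not_bicolored/negP : cycle (fun u v => (f u == h true) != (f v == h true)) d.
    apply: (sub_in_cycle (P := mem d)) cd; last exact/allP.
    by move=> u v ud vd uv; apply: (two_colors (c := c)); rewrite ?fc ?fP.
  by rewrite dodd.
case: side => side.
  exists f1.
  have r0d v : v \in d -> v != r0.
    move=> /side/orP[Fv|xv]; first exact: neF.
    by apply: contraNneq xr0 => <-.
  split=> [v vd|u v ud vd]; last by apply: f1P; apply: r0d.
  case/orP: (side v vd) => [Fv|xv]; first by have := allP dT v vd; rewrite /T Fv.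
  by rewrite eq_sym -f1x; apply: f1P (r0d v vd) xv; rewrite eq_sym.
exists f2; split=> [v vd|u v ud vd].
  by have := allP dT v vd; rewrite /T (negbTE (side v vd)).
by apply: f2P; rewrite eq_sym neF ?side.
Qed.

End NoLongOddHole.

(** * Skeletons *)

Section Skeleton.
Variables (G : sgraph) (x0 : G).

(* A segment [(a, b, s)] joins the nodes labelled [a] and [b] and has the
   interior vertices [s], listed from [a] to [b]. *)
Definition segment : Type := nat * nat * seq G.
Implicit Types (nd : seq G) (sg : seq segment) (v t : nat) (st : nat * bool).

Definition seg_vertices nd (s : segment) : seq G :=
  nth x0 nd s.1.1 :: rcons s.2 (nth x0 nd s.1.2).

Definition skel_vertices nd sg : seq G := nd ++ flatten [seq s.2 | s <- sg].

(** The last clause is what turns the description of a subgraph into one of the induced subgraph on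
    these vertices. *)
Definition skeleton nd sg : Prop :=
  [/\ uniq (skel_vertices nd sg),
      all (fun s => (s.1.1 < size nd) && (s.1.2 < size nd)) sg,
      all (fun s => sorted (@adj G) (seg_vertices nd s)) sg &
      {in skel_vertices nd sg &, forall x y, adj x y ->
        has (fun s => on_path_edge (seg_vertices nd s) x y) sg}].

Lemma infix2_split (s1 s2 : seq G) u x y :
  infix [:: x; y] (s1 ++ u :: s2) ->
  infix [:: x; y] (rcons s1 u) || infix [:: x; y] (u :: s2).
Proof.
elim: s1 => [|v s1 IHs]; first by rewrite cat0s => ->; rewrite orbT.
rewrite cat_cons rcons_cons !(infix_consl _ v) => /orP[xy|/IHs/orP[] ->]; rewrite ?orbT //.
suff -> : prefix [:: x; y] (v :: rcons s1 u) by [].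
move: xy; rewrite !prefix_cons => /andP[->].
by case: s1 {IHs} => [|w s1] /=; rewrite ?prefix_cons ?prefix0s.
Qed.

Lemma on_path_edge_split (s1 s2 : seq G) u x y :
  on_path_edge (s1 ++ u :: s2) x y ->
  on_path_edge (rcons s1 u) x y || on_path_edge (u :: s2) x y.
Proof.
rewrite /on_path_edge.
by case/orP=> /infix2_split/orP[] ->; rewrite ?orbT.
Qed.

Lemma skel_vertices_subdivide nd sgA a b s1 y s2 sgB :
  perm_eq (skel_vertices (rcons nd y) (sgA ++ (a, size nd, s1) :: (size nd, b, s2) :: sgB))
          (skel_vertices nd (sgA ++ (a, b, s1 ++ y :: s2) :: sgB)).
Proof.
apply/seq.permP=> P; rewrite /skel_vertices !map_cat !flatten_cat /= -cats1.
by rewrite !(count_cat, catA) /=; clear; lia.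
Qed.

(** An interior vertex is promoted to a node so that routes can end there. Labels are positions, so
    the new node is appended and the old labels keep their meaning. *)
Lemma skeleton_subdivide nd sgA a b s1 y s2 sgB :
    skeleton nd (sgA ++ (a, b, s1 ++ y :: s2) :: sgB) ->
  skeleton (rcons nd y) (sgA ++ (a, size nd, s1) :: (size nd, b, s2) :: sgB).
Proof.
set sg := sgA ++ _; set sg' := sgA ++ _ => -[uV ends paths edges].
have pV : perm_eq (skel_vertices (rcons nd y) sg') (skel_vertices nd sg).
  exact: skel_vertices_subdivide.
have svE s : (s.1.1 < size nd) && (s.1.2 < size nd) ->
    seg_vertices (rcons nd y) s = seg_vertices nd s.
  by case/andP=> la lb; rewrite /seg_vertices !nth_rcons la lb.
move: ends paths; rewrite !all_cat /= => /and3P[eA /andP[la lb] eB] /and3P[pA pab pB].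
have svA : {in sgA, forall s, seg_vertices (rcons nd y) s = seg_vertices nd s}.
  by move=> s /(allP eA); apply: svE.
have svB : {in sgB, forall s, seg_vertices (rcons nd y) s = seg_vertices nd s}.
  by move=> s /(allP eB); apply: svE.
have sv1 : seg_vertices (rcons nd y) (a, size nd, s1) = rcons (nth x0 nd a :: s1) y.
  by rewrite /seg_vertices /= !nth_rcons la ltnn eqxx.
have sv2 : seg_vertices (rcons nd y) (size nd, b, s2) = y :: rcons s2 (nth x0 nd b).
  by rewrite /seg_vertices /= !nth_rcons lb ltnn eqxx.
have sv12 : seg_vertices nd (a, b, s1 ++ y :: s2) =
    (nth x0 nd a :: s1) ++ y :: rcons s2 (nth x0 nd b).
  by rewrite /seg_vertices /= rcons_cat.
split.
- by rewrite (perm_uniq pV).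
- rewrite /sg' all_cat /= size_rcons !ltnS leqnn !(ltnW la, ltnW lb) /=.
  apply/andP; split.
    by apply: sub_all eA => s /andP[sa sb]; apply/andP; split; apply: ltnW.
  by apply: sub_all eB => s /andP[sa sb]; apply/andP; split; apply: ltnW.
- apply/allP=> s; rewrite mem_cat !inE => /or4P[sA|/eqP->|/eqP->|sB].
  + by rewrite svA //; apply: (allP pA).
  + rewrite sv1; move: pab; rewrite -[path _ _ _]/(sorted _ (seg_vertices nd (a, b, s1 ++ y :: s2))).
    by rewrite sv12 -cat_rcons => /cat_sorted2[].
  + rewrite sv2; move: pab; rewrite -[path _ _ _]/(sorted _ (seg_vertices nd (a, b, s1 ++ y :: s2))).
    by rewrite sv12 => /cat_sorted2[].
  + by rewrite svB //; apply: (allP pB).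
move=> u v uV' vV' uv.
have := edges u v; rewrite -!(perm_mem pV) => /(_ uV' vV' uv).
case/hasP=> s; rewrite mem_cat inE => /or3P[sA|/eqP->|sB] e.
- by apply/hasP; exists s; rewrite ?mem_cat ?sA // svA.
- rewrite has_cat -[has _ (_ :: _)]/[|| _, _ | _] sv1 sv2.
  by move: e; rewrite sv12 => /on_path_edge_split/orP[] ->; rewrite !orbT.
- by apply/hasP; exists s; rewrite ?mem_cat ?inE ?sB ?orbT // svB.
Qed.

(* The model of a path of segments is a list of pairs [(k, d)], each telling
   to run through the [k]-th segment, forwards if [d] and backwards if not. *)
Section Model.
Variable sg : seq segment.

Definition seg_at k : segment := nth (0, 0, [::]) sg k.
Definition step_src st := if st.2 then (seg_at st.1).1.1 else (seg_at st.1).1.2.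
Definition step_dst st := if st.2 then (seg_at st.1).1.2 else (seg_at st.1).1.1.
Definition step_body st := if st.2 then (seg_at st.1).2 else rev (seg_at st.1).2.

Fixpoint chain v (sts : seq (nat * bool)) : bool :=
  if sts is st :: r then
    [&& st.1 < size sg, step_src st == v & chain (step_dst st) r]
  else true.

(** A segment that is not run through yields a chord only when it is a single edge between two
    visited nodes. *)
Definition chordfree (vis : seq nat) (sts : seq (nat * bool)) : bool :=
  all (fun k => [|| k \in [seq st.1 | st <- sts], (seg_at k).1.1 \notin vis,
                   (seg_at k).1.2 \notin vis | 0 < size (seg_at k).2])
      (iota 0 (size sg)).

Definition model_length (sts : seq (nat * bool)) : nat :=
  sumn [seq (size (seg_at st.1).2).+1 | st <- sts].

(** The starting node is left out, so that trails concatenate and a closed trail lists each vertex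
    of its cycle once. *)
Definition trail nd sts : seq G :=
  flatten [seq rcons (step_body st) (nth x0 nd (step_dst st)) | st <- sts].

Lemma size_trail nd sts : size (trail nd sts) = model_length sts.
Proof.
rewrite /trail size_flatten /shape -map_comp; congr sumn; apply: eq_map => st /=.
by rewrite size_rcons /step_body; case: ifP; rewrite ?size_rev.
Qed.

Variable nd : seq G.
Hypothesis sk : skeleton nd sg.

Lemma seg_at_in k : k < size sg -> seg_at k \in sg.
Proof. exact: mem_nth. Qed.

Lemma seg_ends k : k < size sg ->
  (seg_at k).1.1 < size nd /\ (seg_at k).1.2 < size nd.
Proof. by case: sk => _ /allP ends _ _ /seg_at_in/ends/andP. Qed.

Lemma uniq_flatten_nth (ss : seq (seq G)) i j x :
  uniq (flatten ss) -> x \in nth [::] ss i -> x \in nth [::] ss j -> i = j.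
Proof.
elim: ss i j => [|s ss IHs] [|i] [|j] //=; rewrite cat_uniq => /and3P[_ dis u].
- move=> xs xj; case/hasP: dis; exists x => //.
  by apply/flattenP; exists (nth [::] ss j) => //; apply: mem_nth; case: ltnP xj => // /(nth_default [::])->.
- move=> xi xs; case/hasP: dis; exists x => //.
  by apply/flattenP; exists (nth [::] ss i) => //; apply: mem_nth; case: ltnP xi => // /(nth_default [::])->.
- by move=> xi xj; rewrite (IHs i j).
Qed.

Lemma body_inj i j x : x \in (seg_at i).2 -> x \in (seg_at j).2 -> i = j.
Proof.
case: sk; rewrite cat_uniq => /and3P[_ _ u] _ _ _.
have E k : (seg_at k).2 = nth [::] [seq s.2 | s <- sg] k.
  have [lt|ge] := ltnP k (size sg); first by rewrite (nth_map (0, 0, [::])).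
  by rewrite /seg_at !nth_default ?size_map.
by rewrite !E; apply: uniq_flatten_nth.
Qed.

Lemma body_in k x : k < size sg -> x \in (seg_at k).2 ->
  x \in flatten [seq s.2 | s <- sg].
Proof. by move=> /seg_at_in kin xk; apply/flattenP; exists (seg_at k).2 => //; apply: map_f. Qed.

Lemma body_not_node k m : k < size sg -> m < size nd -> nth x0 nd m \notin (seg_at k).2.
Proof.
move=> lk lm; case: sk; rewrite cat_uniq => /and3P[_ /hasPn dis _] _ _ _.
by apply/negP=> /(body_in lk)/dis; rewrite /= mem_nth.
Qed.

Lemma body_uniq k : k < size sg -> uniq (seg_at k).2.
Proof.
move=> /seg_at_in/(map_f snd)/=; case: sk; rewrite cat_uniq => /and3P[_ _ u] _ _ _.
elim: [seq s.2 | s <- sg] u => //= s ss IHs; rewrite cat_uniq => /and3P[us _ u].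
by rewrite inE => /orP[/eqP->//|]; apply: IHs.
Qed.

Lemma node_inj m m' : m < size nd -> m' < size nd ->
  nth x0 nd m = nth x0 nd m' -> m = m'.
Proof.
move=> lm lm' /eqP; case: sk; rewrite cat_uniq => /and3P[u _ _] _ _ _.
by rewrite nth_uniq // => /eqP.
Qed.

Lemma mem_step_body st : step_body st =i (seg_at st.1).2.
Proof. by move=> x; rewrite /step_body; case: ifP; rewrite ?mem_rev. Qed.

Lemma step_dst_lt st : st.1 < size sg -> step_dst st < size nd.
Proof. by move=> /seg_ends[la lb]; rewrite /step_dst; case: ifP. Qed.

Lemma step_list st : st.1 < size sg ->
  nth x0 nd (step_src st) :: rcons (step_body st) (nth x0 nd (step_dst st)) =
  if st.2 then seg_vertices nd (seg_at st.1) else rev (seg_vertices nd (seg_at st.1)).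
Proof.
move=> _; rewrite /step_src /step_body /step_dst /seg_vertices; case: ifP => //.
by rewrite rev_cons rev_rcons.
Qed.

Lemma chain_lt v sts : chain v sts -> {in sts, forall st, st.1 < size sg}.
Proof.
elim: sts v => //= st r IHr v /and3P[lt _ /IHr h] st'; rewrite inE.
by case/orP=> [/eqP->//|]; apply: h.
Qed.

Lemma trail_path v sts : chain v sts -> path (@adj G) (nth x0 nd v) (trail nd sts).
Proof.
elim: sts v => //= st r IHr v /and3P[lt /eqP <- /IHr pr].
rewrite /trail /= cat_path last_rcons pr andbT.
rewrite -[path _ _ _]/(sorted _ (_ :: _)) step_list //.
case: sk => _ _ /allP/(_ _ (seg_at_in lt)) ps _.
by case: ifP; rewrite ?sorted_rev.
Qed.

Lemma trail_last v sts :
  last (nth x0 nd v) (trail nd sts) = nth x0 nd (last v (map step_dst sts)).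
Proof. by elim: sts v => //= st r IHr v; rewrite /trail /= last_cat last_rcons IHr. Qed.

Lemma mem_trail sts x : x \in trail nd sts ->
  (exists2 m, m \in map step_dst sts & x = nth x0 nd m) \/
  (exists2 k, k \in [seq st.1 | st <- sts] & x \in (seg_at k).2).
Proof.
case/flattenP=> s /mapP[st stin ->]; rewrite mem_rcons inE => /orP[/eqP->|].
  by left; exists (step_dst st) => //; apply: map_f.
by rewrite mem_step_body => xs; right; exists st.1 => //; apply: map_f.
Qed.

(** Distinct destinations do not suffice: going along a segment and straight back repeats its
    interior but no destination. *)
Lemma trail_uniq v sts : chain v sts -> uniq (map step_dst sts) ->
  uniq [seq st.1 | st <- sts] -> uniq (trail nd sts).
Proof.
elim: sts v => //= st r IHr v /and3P[lt _ ch] /andP[dst_r ud] /andP[st_r us].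
rewrite /trail /= cat_uniq rcons_uniq -/(trail nd r) (IHr _ ch) // andbT.
have ltr := chain_lt ch.
have -> /= : uniq (step_body st).
  by rewrite /step_body; case: ifP; rewrite ?rev_uniq body_uniq.
rewrite mem_step_body body_not_node //=; last exact: step_dst_lt.
apply/hasPn=> x /mem_trail[[m /mapP[st' st'r ->] ->]|[k kr xk]].
  have lt' := step_dst_lt (ltr _ st'r).
  rewrite /= mem_rcons inE negb_or mem_step_body body_not_node // andbT.
  apply: contra dst_r => /eqP/(node_inj lt' (step_dst_lt lt))<-; exact: map_f.
rewrite /= mem_rcons inE negb_or mem_step_body; apply/andP; split.
  apply: contraL xk => /eqP->; apply: body_not_node; last exact: step_dst_lt.
  by case/mapP: kr => st' /ltr lt' ->.
by apply: contra st_r => xs; rewrite (body_inj xs xk).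
Qed.

Lemma trail_edge v sts st x y : chain v sts -> st \in sts ->
  on_path_edge (seg_vertices nd (seg_at st.1)) x y ->
  on_path_edge (nth x0 nd v :: trail nd sts) x y.
Proof.
elim: sts v => //= st' r IHr v /and3P[lt /eqP vE ch]; rewrite inE => /orP[/eqP->|str] e.
  rewrite -vE /trail /= -/(trail nd r) -cat_cons.
  apply: on_path_edge_infix (prefix_infix _ (trail nd r)) _.
  by rewrite step_list //; case: ifP; rewrite ?on_path_edge_rev.
apply: on_path_edge_infix (IHr _ ch str e).
rewrite [trail nd (st' :: r)](_ : _ = rcons (step_body st') (nth x0 nd (step_dst st')) ++ trail nd r) //.
by rewrite cat_rcons -cat_cons suffix_infix.
Qed.

Lemma trail_chordfree v sts x y : v < size nd -> chain v sts ->
    chordfree (v :: map step_dst sts) sts ->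
    x \in nth x0 nd v :: trail nd sts -> y \in nth x0 nd v :: trail nd sts ->
    adj x y ->
  on_path_edge (nth x0 nd v :: trail nd sts) x y.
Proof.
move=> lv ch cf xK yK xy.
have ltr := chain_lt ch.
have vert u : u \in nth x0 nd v :: trail nd sts ->
    (exists2 m, (m \in v :: map step_dst sts) && (m < size nd) & u = nth x0 nd m) \/
    (exists2 k, (k \in [seq st.1 | st <- sts]) && (k < size sg) & u \in (seg_at k).2).
  rewrite inE => /orP[/eqP->|/mem_trail[[m md ->]|[k kd uk]]].
  - by left; exists v; rewrite ?inE ?eqxx ?lv.
  - left; exists m => //; rewrite inE md orbT /=.
    by case/mapP: md => st /ltr lt ->; apply: step_dst_lt.
  - by right; exists k => //; rewrite kd; case/mapP: kd => st /ltr lt ->.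
have inV u : u \in nth x0 nd v :: trail nd sts -> u \in skel_vertices nd sg.
  case/vert=> [[m /andP[_ lm] ->]|[k /andP[_ lk] uk]]; rewrite mem_cat.
    by rewrite mem_nth.
  by rewrite (body_in lk uk) orbT.
case: sk => uV _ _ /(_ x y (inV x xK) (inV y yK) xy)/hasP[s sin e].
have [k lk sE] : exists2 k, k < size sg & s = seg_at k.
  by exists (index s sg); rewrite ?index_mem // /seg_at nth_index.
rewrite {s sin}sE in e.
have [/mapP[st stin kE]|kn] := boolP (k \in [seq st.1 | st <- sts]).
  by apply: (trail_edge ch stin); rewrite -kE.
have [la lb] := seg_ends lk.
have onseg u : u \in nth x0 nd v :: trail nd sts -> u \in seg_vertices nd (seg_at k) ->
    (u = nth x0 nd (seg_at k).1.1 /\ (seg_at k).1.1 \in v :: map step_dst sts) \/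
    (u = nth x0 nd (seg_at k).1.2 /\ (seg_at k).1.2 \in v :: map step_dst sts).
  move=> /vert uv; rewrite inE mem_rcons inE => /or3P[/eqP uE|/eqP uE|uk].
  - left; split=> //; case: uv => [[m /andP[mv lm]]|[k' /andP[_ lk']]]; rewrite uE.
      by move/(node_inj la lm)->.
    by rewrite (negbTE (body_not_node _ _)).
  - right; split=> //; case: uv => [[m /andP[mv lm]]|[k' /andP[_ lk']]]; rewrite uE.
      by move/(node_inj lb lm)->.
    by rewrite (negbTE (body_not_node _ _)).
  - case: uv => [[m /andP[_ lm] uE]|[k' /andP[k'in lk'] uk']].
      by move: uk; rewrite uE (negbTE (body_not_node _ _)).
    by move: kn; rewrite (body_inj uk uk') k'in.
have [xs ys] : x \in seg_vertices nd (seg_at k) /\ y \in seg_vertices nd (seg_at k).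
  by case/orP: e => /infixP[s1 [s2 ->]]; rewrite !mem_cat !inE !eqxx ?orbT.
have nxy : x != y by apply: contraTneq xy => ->; rewrite adj_irrefl.
have long : 0 < size (seg_at k).2 -> False.
  have uk := body_uniq lk; have nak := body_not_node lk la; have nbk := body_not_node lk lb.
  move: e (onseg x xK xs) (onseg y yK ys); rewrite /seg_vertices.
  set A := nth x0 nd _ in nak *; set B := nth x0 nd _ in nbk *.
  case: (seg_at k).2 uk nak nbk => // w r uw nAw nBw e xAB yAB _.
  have key u u' : infix [:: u; u'] (A :: rcons (w :: r) B) -> (u == A) || (u == B) ->
      (u' == A) || (u' == B) -> u == u'.
    case/infixP=> [[|A' s1]] [s2] /=.
      case=> _ <- _ _ /orP[] /eqP wE.
        by move: nAw; rewrite -wE inE eqxx.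
      by move: nBw; rewrite -wE inE eqxx.
    case=> _ sE.
    have : u \in w :: r.
      have [|[s2' s2E]] : s2 = [::] \/ exists s2', s2 = rcons s2' B.
      - case/lastP: s2 sE => [|s2 B']; [by left|move=> sE; right; exists s2].
        have := congr1 (last B) sE; rewrite -rcons_cons !last_rcons last_cat /= last_rcons.
        by move=> <-.
      - move=> s2E; have /rcons_inj[-> _] : rcons (w :: r) B = rcons (rcons s1 u) u'.
          by rewrite rcons_cons sE s2E -!cats1 -catA.
        by rewrite mem_rcons inE eqxx.
      have /rcons_inj[->] : rcons (w :: r) B = rcons (s1 ++ u :: u' :: s2') B.
        by rewrite rcons_cons sE s2E -!cats1 -!catA.
      by rewrite mem_cat inE eqxx orbT.
    by move=> uwr /orP[] /eqP uE; move: uwr; rewrite uE ?(negbTE nAw) ?(negbTE nBw).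
  have xE : (x == A) || (x == B) by case: xAB => [] [-> _]; rewrite eqxx ?orbT.
  have yE : (y == A) || (y == B) by case: yAB => [] [-> _]; rewrite eqxx ?orbT.
  case/orP: e => /key; first by move=> /(_ xE yE); rewrite (negbTE nxy).
  by move=> /(_ yE xE); rewrite eq_sym (negbTE nxy).
have : k \in iota 0 (size sg) by rewrite mem_iota.
move/(allP cf); rewrite (negbTE kn) /= => /or3P[|| /long //].
- case: (onseg x xK xs) (onseg y yK ys) => [[_ ->//]|[xE _]] [[_ ->//]|[yE _]].
  by move: nxy; rewrite xE yE eqxx.
- case: (onseg x xK xs) (onseg y yK ys) => [[xE _]|[_ ->//]] [[yE _]|[_ ->//]].
  by move: nxy; rewrite xE yE eqxx.
Qed.

End Model.
End Skeleton.

(** * Induced paths, chordless cycles and jumps realised from models *)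

Section SkeletonRealisation.
Variables (G : sgraph) (x0 : G) (nd : seq G) (sg : seq (segment G)).
Hypothesis sk : skeleton x0 nd sg.
Implicit Types (v t : nat) (sts : seq (nat * bool)).

Definition visited v sts : seq nat := v :: map (step_dst sg) sts.

Definition model_path v t sts : bool :=
  [&& v < size nd, chain sg v sts, uniq (visited v sts),
      uniq [seq st.1 | st <- sts], last v (map (step_dst sg) sts) == t & v != t].

Lemma trail_vertex v sts x : v < size nd -> chain sg v sts ->
    x \in nth x0 nd v :: trail x0 sg nd sts ->
  x \in skel_vertices nd sg /\
  (forall m, m < size nd -> x = nth x0 nd m -> m \in visited v sts).
Proof.
move=> lv ch; have ltr := chain_lt ch.
have node m : m \in visited v sts -> m < size nd.
  by rewrite inE => /orP[/eqP->//|/mapP[st /ltr lt ->]]; exact: (step_dst_lt sk lt).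
rewrite inE => /orP[/eqP->|/mem_trail[[m md ->]|[k /mapP[st /ltr lt ->] xk]]].
- split; first by rewrite mem_cat mem_nth.
  by move=> m lm /(node_inj sk lv lm)<-; rewrite inE eqxx.
- have mv : m \in visited v sts by rewrite inE md orbT.
  split; first by rewrite mem_cat mem_nth ?node.
  by move=> m' lm' /(node_inj sk (node _ mv) lm')<-.
- split; first by rewrite mem_cat (body_in lt xk) orbT.
  by move=> m lm xE; move: xk; rewrite xE (negbTE (body_not_node sk lt lm)).
Qed.

Lemma skeleton_path v t sts :
    model_path v t sts -> chordfree sg (visited v sts) sts ->
  exists K, [/\ induced_path K, size K = (model_length sg sts).+1,
    head x0 K = nth x0 nd v, last x0 K = nth x0 nd t &
    {in K, forall x, x \in skel_vertices nd sg /\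
      (forall m, m < size nd -> x = nth x0 nd m -> m \in visited v sts)}].
Proof.
case/andP=> lv /and5P[ch uv us /eqP lt _] cf.
exists (nth x0 nd v :: trail x0 sg nd sts); split=> //.
- split; last by move=> x y xK yK; apply: trail_chordfree.
    rewrite /= (trail_uniq sk ch) // ?andbT; last by case/andP: uv.
    apply/negP=> /mem_trail[[m md]|[k /mapP[st /(chain_lt ch) ltst ->]]].
      move/(node_inj sk lv)=> vm; move: uv; rewrite /= vm ?md //.
      by case/mapP: md => st /(chain_lt ch) ltst ->; exact: (step_dst_lt sk ltst).
    by rewrite (negbTE (body_not_node sk ltst lv)).
  exact: trail_path.
- by rewrite /= size_trail.
- by rewrite /= trail_last lt.
- by move=> x; apply: trail_vertex.
Qed.

Lemma skeleton_cycle v sts :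
    v < size nd -> chain sg v sts -> uniq (map (step_dst sg) sts) ->
    uniq [seq st.1 | st <- sts] -> last v (map (step_dst sg) sts) = v ->
    chordfree sg (visited v sts) sts -> 3 <= model_length sg sts ->
  exists c, [/\ is_cycle c, chordless c, size c = model_length sg sts,
    {subset c <= skel_vertices nd sg} & {in sts, forall st, {subset seg_vertices x0 nd (seg_at sg st.1) <= c}}].
Proof.
move=> lv ch ud us lst cf len.
set T := trail x0 sg nd sts.
have sT : size T = model_length sg sts by rewrite size_trail.
have lT : last (nth x0 nd v) T = nth x0 nd v by rewrite trail_last lst.
have uT : uniq T by exact: (trail_uniq sk ch ud us).
have pT : path (@adj G) (nth x0 nd v) T by exact: (trail_path sk ch).
have cfT x y : x \in nth x0 nd v :: T -> y \in nth x0 nd v :: T -> adj x y ->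
    on_path_edge (nth x0 nd v :: T) x y by apply: trail_chordfree.
have TV x : x \in nth x0 nd v :: T -> x \in skel_vertices nd sg.
  by case/(trail_vertex lv ch).
have subT : {in sts, forall st,
    {subset seg_vertices x0 nd (seg_at sg st.1) <= nth x0 nd v :: T}}.
  rewrite /T; move: ch; clear -sk; elim: sts v => //= st r IHr v /and3P[lt /eqP vE ch] st'.
  rewrite inE => /orP[/eqP->|st'r] x xs.
    rewrite /trail /= -/(trail _ _ _ r) -cat_cons mem_cat -vE step_list //.
    by case: ifP; rewrite ?mem_rev xs.
  have := IHr _ ch st' st'r x xs.
  rewrite /trail /= -/(trail _ _ _ r) !inE mem_cat mem_rcons inE.
  by case/orP=> ->; rewrite ?orbT.
case/lastP: T => [|T w] in sT lT uT pT cfT TV subT; first by rewrite -sT in len.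
rewrite last_rcons in lT; subst w.
have uT' : uniq (nth x0 nd v :: T) by move: uT; rewrite rcons_uniq.
exists (nth x0 nd v :: T); split.
- by rewrite /is_cycle /= -[X in _ < X](size_rcons T (nth x0 nd v)) sT len pT -[_ && uniq T]/(uniq (_ :: T)) uT'.
- apply: chordless_on_path_edge => // x y xT yT; apply: cfT.
    by rewrite -rcons_cons mem_rcons inE xT orbT.
  by rewrite -rcons_cons mem_rcons inE yT orbT.
- by rewrite -sT size_rcons.
- by move=> x xT; apply: TV; rewrite -rcons_cons mem_rcons inE xT orbT.
- by move=> st stin x /(subT st stin); rewrite inE mem_rcons !inE => /or3P[]->; rewrite ?orbT.
Qed.

Variables (l : nat).
Hypothesis girth_ge : forall c : seq G, is_cycle c -> 2 * l + 1 <= size c.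
Hypothesis hodd : forall c : seq G, odd_hole c -> ~~ (2 * l + 3 <= size c).
Hypothesis hl : 2 <= l.

(** [W] lies outside the skeleton and closes up with the model path from [v] to [t]. Among the
    possible attachments [Y] of the last vertex of [W], the model may visit only its end [t]; the
    attachments in [E], allowed for any vertex of [W], it must avoid altogether. The number [n]
    counts the vertices of the resulting chordless cycle. *)
Lemma jump_length v t sts (W : seq G) (Y E : seq nat) :
    induced_path W -> 0 < size W -> {in W, forall w, w \notin skel_vertices nd sg} ->
    {in W, forall w, {in skel_vertices nd sg, forall x, adj w x ->
      [\/ w = head x0 W /\ x = nth x0 nd v,
          w = last x0 W /\ x \in [seq nth x0 nd m | m <- Y] |
          x \in [seq nth x0 nd m | m <- E]]}} ->
    adj (nth x0 nd v) (head x0 W) -> adj (nth x0 nd t) (last x0 W) ->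
    model_path v t sts ->
    all (fun m => (m < size nd) && ((m == t) || (m \notin visited v sts))) Y ->
    all (fun m => (m < size nd) && (m \notin visited v sts)) E ->
    chordfree sg (visited v sts) sts ->
  let n := size W + (model_length sg sts).+1 in
  2 * l + 1 <= n /\ (odd n -> n = 2 * l + 1).
Proof.
move=> iW W0 WV att ev et mp YP EP cf n.
have vt : v != t by case/andP: mp => _ /and5P[].
have sts0 : 0 < model_length sg sts.
  case/andP: (mp) => _ /and5P[_ _ _]; case: (sts) => [/eqP <-|st r _ _]; first by rewrite eqxx.
  by rewrite /model_length /= addSn.
have [K [iK sK hK lK KV]] := skeleton_path mp cf.
have hr : head x0 (rev W) = last x0 W.
  by case/lastP: (W) => // s w; rewrite rev_rcons last_rcons.
have lr : last x0 (rev W) = head x0 W.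
  by case: (W) => // w s; rewrite rev_cons last_rcons.
have sz : size (K ++ rev W) = n by rewrite size_cat size_rev sK addnC.
have [cyc ch] : is_cycle (K ++ rev W) /\ chordless (K ++ rev W).
  apply: (hole_join (x0 := x0)) iK (induced_path_rev iW) _ _ _ _ _ _ _.
  - by rewrite sK.
  - by rewrite size_rev.
  - by rewrite size_rev sK; move: sts0 W0; clear; lia.
  - by move=> x /KV[xV _]; rewrite mem_rev; apply: contraTN xV => /WV.
  - by rewrite lK hr.
  - by rewrite hK lr adj_sym.
  move=> x y xK; rewrite mem_rev => yW xy; have [xV xvis] := KV x xK.
  have := att y yW x xV; rewrite adj_sym xy hr lr lK hK => /(_ isT).
  case=> [[-> ->]|[-> /mapP[m mY xE]]|/mapP[m mE xE]]; first by right.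
    left; split=> //; have /andP[lm] := allP YP m mY; rewrite xvis // orbF => /eqP <-.
    by [].
  by have /andP[lm] := allP EP m mE; rewrite xvis.
rewrite -sz; split; first exact: girth_ge.
exact: odd_hole_size.
Qed.

End SkeletonRealisation.

(** * The skeleton of a K4-subdivision *)

Lemma infix2_uniq (T : eqType) (s1 s2 : seq T) (x y z : T) :
  uniq (s1 ++ x :: s2) -> infix [:: x; y] (s1 ++ x :: s2) -> y = head z s2.
Proof.
move=> u /infixP[t1 [t2 E]].
have ix : index x (s1 ++ x :: s2) = size s1.
  rewrite index_cat /= eqxx addn0.
  by move: u; rewrite cat_uniq /= negb_or => /and3P[_ /andP[/negbTE->]].
have it : index x (s1 ++ x :: s2) = size t1.
  move: u; rewrite E index_cat /= eqxx addn0 cat_uniq /= negb_or.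
  by case/and3P=> _ /andP[/negbTE->].
have := congr1 (drop (size s1).+1) E; rewrite -add1n -!drop_drop.
rewrite drop_size_cat // -ix it drop_size_cat //= !drop0.
by move=> ->.
Qed.

(** A branch vertex has at most one neighbour on each of its three subdivided edges, and any other
    vertex has at most the two on its own path. An arris excludes from its interior only vertices of
    degree exactly 3; with this bound the interior degrees are at most 2. *)
Lemma subdivision_degree_le3 (H : sgraph) (h : H) :
  is_subdivision (complete 4) H -> degree h <= 3.
Proof.
case=> b [p [binj pP pb pdis [cover edges]]].
have edge_mem (s : seq H) x y : on_path_edge s x y -> x \in s.
  by case/orP=> /infixP[s1 [s2 ->]]; rewrite !mem_cat !inE eqxx ?orbT.
have [/existsP[z /eqP hz]|/existsPn hnb] := boolP [exists z, h == b z].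
  pose f (w : 'I_4) := nth h (p z w) 1.
  suff /subset_leq_card : [set k | adj h k] \subset [set f w | w in [set~ z]].
    move=> le; apply: leq_trans le _; apply: leq_trans (leq_imset_card _ _) _.
    by rewrite cardsC1 card_ord.
  have key y k : adj (z : complete 4) y -> on_path_edge (p z y) h k ->
      k \in [set f w | w in [set~ z]].
    move=> zy; have [[q [pE _ uq _]] _] := pP z y zy => e.
    apply/imsetP; exists y; first by rewrite !inE eq_sym.
    rewrite /f pE; move: e; rewrite /on_path_edge pE -hz => /orP[] e.
      by rewrite pE -hz in uq; rewrite (infix2_uniq (s1 := [::]) h uq e) -nth0.
    rewrite pE -hz in uq; case/infixP: e => [[|a s1]] [s2 /= [E1 E2]].
      by move: uq; rewrite E2 /= inE E1 eqxx.
    by move: uq; rewrite E2 /= mem_cat !inE eqxx !orbT.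
  apply/subsetP=> k; rewrite inE => /edges[x [y [xy e]]].
  have hp := edge_mem _ _ _ e; rewrite hz in hp.
  case: (pb x y z xy hp) => zE; rewrite -zE in xy e; first exact: key e.
  apply: (key x); first by rewrite adj_sym.
  by case: (pP x z xy) => _ ->; rewrite on_path_edge_rev.
have [[z hz]|[x [y [xy hp]]]] := cover h; first by have := hnb z; rewrite hz eqxx.
have {hp}[s1 [s2 pE]] := mem_split hp.
suff /subset_leq_card : [set k | adj h k] \subset [set head h s2; last h s1].
  by move=> le; apply: leq_trans le _; rewrite cards2; case: (_ != _).
apply/subsetP=> k; rewrite inE => /edges[x' [y' [xy' e]]].
have hp' := edge_mem _ _ _ e.
have {}e : on_path_edge (p x y) h k.
  have [sE|sne] := eqVneq [set x; y] [set x'; y']; last first.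
    have hp : h \in p x y by rewrite pE mem_cat inE eqxx orbT.
    have [z hz] := pdis x y x' y' xy xy' sne h hp hp'.
    by have := hnb z; rewrite hz eqxx.
  have xin : x \in [set x'; y'] by rewrite -sE !inE eqxx.
  have yin : y \in [set x'; y'] by rewrite -sE !inE eqxx orbT.
  rewrite !inE in xin yin; have xny : x != y := xy.
  case/orP: xin => /eqP xE; case/orP: yin => /eqP yE; rewrite xE yE ?eqxx // in xny *.
  by case: (pP x' y' xy') => _ ->; rewrite on_path_edge_rev.
have [[q [_ _ up _]] _] := pP x y xy; rewrite pE in up e.
rewrite !inE; case/orP: e => e; first by rewrite (infix2_uniq h up e) eqxx.
have up' : uniq (rev s2 ++ h :: rev s1) by rewrite -cat_rcons -rev_cons -rev_cat rev_uniq.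
have /(infix2_uniq h up') -> : infix [:: h; k] (rev s2 ++ h :: rev s1).
  by rewrite -cat_rcons -rev_cons -rev_cat -infix_revLR.
by case/lastP: (s1) => [|t a]; rewrite ?rev_rcons ?last_rcons /= eqxx orbT.
Qed.

Section Arrises.
Variable H : sgraph.
Implicit Types (u v x y : H) (s : seq H).

Definition arris u v s : Prop :=
  [/\ sorted (@adj H) (u :: rcons s v), uniq (u :: rcons s v) &
      {in s, forall x, degree x <= 2}].

Lemma arris_rev u v s : arris u v s -> arris v u (rev s).
Proof.
have E : v :: rcons (rev s) u = rev (u :: rcons s v) by rewrite rev_cons rev_rcons.
by case=> so un de; split; rewrite ?E ?sorted_rev ?rev_uniq // => x; rewrite mem_rev; apply: de.
Qed.

Lemma is_arrisP u v p :
    (forall h : H, degree h <= 3) -> u != v -> is_arris u v p ->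
  exists s, p = u :: rcons s v /\ arris u v s.
Proof.
move=> deg uv [[q [pE pa un lq]] du dv two].
case/lastP: q => [|s w] in pE pa un lq; first by rewrite -lq eqxx in uv.
rewrite last_rcons in lq; subst w; exists s; split=> //; split=> //; first by rewrite -pE.
move=> x xs; have := deg x; rewrite leq_eqVlt ltnS => /orP[/eqP dx|//].
have : #|[set x; u; v]| <= 2.
  rewrite -two; apply/subset_leq_card/subsetP=> y; rewrite !inE pE.
  case/orP=> [/orP[]|] /eqP->; rewrite ?dx ?du ?dv eqxx andbT !inE ?mem_rcons ?inE ?xs ?eqxx ?orbT //.
rewrite pE /= rcons_uniq mem_rcons inE negb_or in un.
case/and3P: un => /andP[_ us] vs _.
rewrite -setUA cardsU1 cards2 uv !inE negb_or.
have -> : x != u by apply: contraNneq us => <-.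
by have -> : x != v by apply: contraNneq vs => <-.
Qed.

(** The neighbours of [x] along the arris are two distinct vertices, which exhaust its degree. *)
Lemma arris_interior_edge u v s x y :
  arris u v s -> x \in s -> adj x y -> on_path_edge (u :: rcons s v) x y.
Proof.
case=> so un de xs; have [s1 [s2 sE]] := mem_split xs.
have pE : u :: rcons s v = rcons (u :: s1) x ++ rcons s2 v.
  by rewrite sE rcons_cat cat_rcons.
move: so un; rewrite pE => so un.
have xb : adj x (head v s2).
  move: so; rewrite /= cat_path last_rcons => /andP[_].
  by case: (s2) => [|b t] /= /andP[].
have ax : adj (last u s1) x by move: so; rewrite /= cat_path rcons_path => /andP[/andP[]].
have ab : last u s1 != head v s2.
  move: un; rewrite cat_uniq => /and3P[_ /hasPn dis _].
  have /dis : head v s2 \in rcons s2 v.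
    by case: (s2) => [|b t]; rewrite /= ?inE ?mem_rcons ?inE eqxx ?orbT.
  by apply: contraNneq => <-; rewrite mem_rcons inE mem_last orbT.
have NE : [set last u s1; head v s2] = [set k | adj x k].
  apply/eqP; rewrite eqEcard cards2 ab de // andbT.
  by apply/subsetP=> k; rewrite !inE => /orP[] /eqP->; rewrite // adj_sym.
move=> xy; have : y \in [set k | adj x k] by rewrite inE.
rewrite -NE !inE => /orP[] /eqP->; apply/orP; [right|left].
  by rewrite cat_rcons (lastI u s1) cat_rcons; apply/infixP; exists (belast u s1), (rcons s2 v).
rewrite cat_rcons; apply/infixP; exists (u :: s1), (behead (rcons s2 v)).
by case: (s2).
Qed.

Lemma sorted_propagate (P : pred H) s x :
    sorted (@adj H) s -> {in s &, forall a b, adj a b -> P a -> P b} ->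
    x \in s -> P x ->
  {in s, forall y, P y}.
Proof.
elim: s x => // h t IHt x so step xs Px.
have sot : sorted (@adj H) t by apply: path_sorted so.
have stept : {in t &, forall a b, adj a b -> P a -> P b}.
  by move=> a b at_ bt; apply: step; rewrite inE ?at_ ?bt orbT.
case: t => [|h' t] in IHt so step xs sot stept *.
  by move=> y; move: xs; rewrite !inE => /eqP<- /eqP->.
have hh' : adj h h' by case/andP: so.
have ht : h' \in h' :: t by rewrite inE eqxx.
have Pt : {in h' :: t, forall y, P y}.
  move: xs; rewrite inE => /orP[/eqP xh|xt]; last exact: (IHt x).
  apply: (IHt h') => //; apply: (step h) => //; rewrite -?xh ?inE ?eqxx ?orbT //.
move=> y; rewrite inE => /orP[/eqP->|]; last exact: Pt.
by apply: (step h') (Pt _ ht); rewrite ?inE ?eqxx ?orbT // adj_sym.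
Qed.

(** No edge leaves an arris from its interior, so a common interior vertex draws all of [s] into
    [s']. The ends of [s] then lie on the other arris, and by their degree they are ends of it. As
    the six arrises have different pairs of ends, their interiors are disjoint. *)
Lemma arris_meet u v s u' v' s' x :
    arris u v s -> arris u' v' s' -> degree u = 3 -> degree v = 3 ->
    degree u' = 3 -> degree v' = 3 -> x \in s -> x \in s' ->
  ((u == u') || (u == v')) && ((v == u') || (v == v')).
Proof.
move=> a a' du dv du' dv' xs xs'.
have [so _ de] := a; have [_ _ de'] := a'.
have nb c d : c \in s' -> adj c d -> [|| d == u', d == v' | d \in s'].
  move=> cs cd; have := arris_interior_edge a' cs cd.
  case/orP=> /infixP[t1 [t2 E]]; have : d \in u' :: rcons s' v'.
  - by rewrite E !mem_cat !inE eqxx !orbT.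
  - by rewrite inE mem_rcons inE.
  - by rewrite E !mem_cat !inE eqxx !orbT.
  - by rewrite inE mem_rcons inE.
have ss : {in s, forall y, y \in s'}.
  apply: (sorted_propagate (P := mem s')) xs xs'.
    by move: so => /= /path_sorted; rewrite -cats1 => /cat_sorted2[].
  move=> c d cs ds cd cs'; case/or3P: (nb c d cs' cd) => // /eqP dE.
    by have := de d ds; rewrite dE du'.
  by have := de d ds; rewrite dE dv'.
have uh : adj (head x s) u.
  by move: so xs; case: (s) => //= b t /andP[ub _] _; rewrite adj_sym.
have vl : adj (last x s) v.
  by move: so xs; case: (s) => //= b t; rewrite rcons_path => /and3P[_ _ ->].
have hs : head x s \in s by case: (s) xs => // b t _; rewrite inE eqxx.
have ls : last x s \in s by case: (s) xs => // b t _; exact: (mem_last b t).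
apply/andP; split.
  case/or3P: (nb _ _ (ss _ hs) uh) => [->//|->|/de']; first by rewrite orbT.
  by rewrite du.
case/or3P: (nb _ _ (ss _ ls) vl) => [->//|->|/de']; first by rewrite orbT.
by rewrite dv.
Qed.

(** The three arrises leave [u] through three distinct neighbours, which exhaust its degree. For an
    arris without interior, the default of [head] gives the right neighbour, namely the other
    end. *)
Lemma node_edge u e1 s1 e2 s2 e3 s3 y :
    degree u = 3 -> arris u e1 s1 -> arris u e2 s2 -> arris u e3 s3 ->
    uniq [:: head e1 s1; head e2 s2; head e3 s3] -> adj u y ->
  [|| on_path_edge (u :: rcons s1 e1) u y, on_path_edge (u :: rcons s2 e2) u y
    | on_path_edge (u :: rcons s3 e3) u y].
Proof.
have ad e s : arris u e s -> adj u (head e s).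
  by case; case: s => [|b t] /= /andP[].
have oe e s : on_path_edge (u :: rcons s e) u (head e s).
  by apply/orP; left; apply/infixP; exists [::], (behead (rcons s e)); case: s.
move=> du a1 a2 a3 un uy.
have NE : [set head e1 s1; head e2 s2; head e3 s3] = [set k | adj u k].
  apply/eqP; rewrite eqEcard; apply/andP; split.
    by apply/subsetP=> k; rewrite !inE => /orP[/orP[]|] /eqP->; apply: ad.
  move: du; rewrite /degree => ->; move: un; rewrite /= !inE negb_or andbT.
  by case/andP=> /andP[n12 n13] n23; rewrite -setUA cardsU1 cards2 n23 !inE negb_or n12 n13.
have : y \in [set k | adj u k] by rewrite inE.
by rewrite -NE !inE => /orP[/orP[]|] /eqP->; rewrite oe ?orbT.
Qed.

End Arrises.

Section K4Skeleton.
Variables (H : sgraph) (u1 u2 u3 u4 : H) (P1 Q1 Q2 P2 L1 L2 : seq H).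
Hypothesis un : uniq [:: u1; u2; u3; u4].
Hypothesis deg : {in [:: u1; u2; u3; u4], forall u, degree u = 3}.

Definition k4_nodes : seq H := [:: u1; u2; u3; u4].
Definition k4_segments : seq (segment H) :=
  [:: (0, 1, P1); (1, 2, Q1); (0, 3, Q2); (3, 2, P2); (0, 2, L1); (3, 1, L2)].

Hypothesis arr : {in k4_segments, forall s,
  arris (nth u1 k4_nodes s.1.1) (nth u1 k4_nodes s.1.2) s.2}.

Lemma k4_segments_disjoint s s' x :
  s \in k4_segments -> s' \in k4_segments -> x \in s.2 -> x \in s'.2 -> s = s'.
Proof.
have lab t : t \in k4_segments -> t.1.1 < 4 /\ t.1.2 < 4.
  by rewrite !inE => /or4P[| | |/or3P[]] => /eqP->.
move=> si s'i xs xs'; have [la lb] := lab s si; have [la' lb'] := lab s' s'i.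
have dn k : k < 4 -> degree (nth u1 k4_nodes k) = 3 by move=> lk; rewrite deg ?mem_nth.
have := arris_meet (arr si) (arr s'i) (dn _ la) (dn _ lb) (dn _ la') (dn _ lb') xs xs'.
rewrite !(nth_uniq u1) //.
move: si s'i; rewrite !inE.
by case/or4P=> [| | |/or3P[]] => /eqP-> /or4P[| | |/or3P[]] => /eqP->.
Qed.

Lemma k4_interior_not_node s k :
  s \in k4_segments -> k < 4 -> nth u1 k4_nodes k \notin s.2.
Proof.
move=> si lk; have [_ _ de] := arr si.
by apply/negP=> /de; rewrite deg // mem_nth.
Qed.

Lemma k4_head_neq s s' k k' (t t' : seq H) :
    s \in k4_segments -> s' \in k4_segments -> s != s' -> t =i s.2 -> t' =i s'.2 ->
    k < 4 -> k' < 4 -> k != k' ->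
  head (nth u1 k4_nodes k) t != head (nth u1 k4_nodes k') t'.
Proof.
move=> si s'i ss' tE t'E lk lk' kk'.
case: t tE => [|b t] tE; case: t' t'E => [|b' t'] t'E /=.
- by rewrite nth_uniq.
- apply: contraNneq (k4_interior_not_node s'i lk) => ->.
  by rewrite -t'E inE eqxx.
- apply: contraNneq (k4_interior_not_node si lk') => <-.
  by rewrite -tE inE eqxx.
- apply: contraNneq ss' => bb'; apply/eqP; apply: (@k4_segments_disjoint _ _ b) => //.
    by rewrite -tE inE eqxx.
  by rewrite bb' -t'E inE eqxx.
Qed.

Lemma k4_skeleton : skeleton u1 k4_nodes k4_segments.
Proof.
have uV : uniq (flatten [seq s.2 | s <- k4_segments]).
  suff gen r : uniq r -> {subset r <= k4_segments} -> uniq (flatten [seq s.2 | s <- r]).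
    by apply: gen.
  elim: r => //= s r IHr /andP[sr ur] sub.
  have si : s \in k4_segments by apply: sub; rewrite inE eqxx.
  rewrite cat_uniq IHr //; last by move=> s' s'r; apply: sub; rewrite inE s'r orbT.
  have [_ /= + _] := arr si; rewrite rcons_uniq => /and3P[_ _ ->] /=; rewrite andbT.
  apply/hasPn=> x /flattenP[t /mapP[s' s'r ->] xs']; apply: contra sr => xs.
  by rewrite (k4_segments_disjoint si _ xs xs') //; apply: sub; rewrite inE s'r orbT.
split=> //.
- rewrite cat_uniq; apply/and3P; split=> //; apply/hasPn=> x /flattenP[t /mapP[s si ->] xs].
  apply/negP=> xn; have := k4_interior_not_node si (k := index x k4_nodes).
  by rewrite -[4]/(size k4_nodes) index_mem nth_index // xs => /(_ xn).
- by apply/allP=> s si; have [+ _ _] := arr si.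
have interior s x y : s \in k4_segments -> x \in s.2 -> adj x y ->
    has (fun s => on_path_edge (seg_vertices u1 k4_nodes s) x y) k4_segments.
  by move=> si xs xy; apply/hasP; exists s => //; apply: arris_interior_edge (arr si) xs xy.
have node x y : x \in k4_nodes -> adj x y ->
    has (fun s => on_path_edge (seg_vertices u1 k4_nodes s) x y) k4_segments.
  have sP1 : (0, 1, P1) \in k4_segments by rewrite !inE eqxx.
  have sQ1 : (1, 2, Q1) \in k4_segments by rewrite !inE eqxx ?orbT.
  have sQ2 : (0, 3, Q2) \in k4_segments by rewrite !inE eqxx ?orbT.
  have sP2 : (3, 2, P2) \in k4_segments by rewrite !inE eqxx ?orbT.
  have sL1 : (0, 2, L1) \in k4_segments by rewrite !inE eqxx ?orbT.
  have sL2 : (3, 1, L2) \in k4_segments by rewrite !inE eqxx ?orbT.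
  have rE (s : segment H) x' y' : on_path_edge (seg_vertices u1 k4_nodes s) x' y' =
      on_path_edge (nth u1 k4_nodes s.1.2 :: rcons (rev s.2) (nth u1 k4_nodes s.1.1)) x' y'.
    by rewrite -on_path_edge_rev rev_cons rev_rcons.
  have hn3 (s s' s'' : segment H) k k' k'' t t' t'' :
      s \in k4_segments -> s' \in k4_segments -> s'' \in k4_segments ->
      t =i s.2 -> t' =i s'.2 -> t'' =i s''.2 -> uniq [:: s; s'; s''] ->
      uniq [:: k; k'; k''] -> all (fun k => k < 4) [:: k; k'; k''] ->
    uniq [:: head (nth u1 k4_nodes k) t; head (nth u1 k4_nodes k') t';
             head (nth u1 k4_nodes k'') t''].
    move=> i i' i'' E E' E''; rewrite /= !inE !negb_or !andbT.
    case/andP=> /andP[n1 n2] n3 /andP[/andP[m1 m2] m3] /and3P[l1 l2 l3].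
    by rewrite (k4_head_neq i i' n1 E E') // (k4_head_neq i i'' n2 E E'') // (k4_head_neq i' i'' n3 E' E'').
  have rv (t : seq H) : rev t =i t by move=> z; rewrite mem_rev.
  have sb (s : segment H) x' : s \in k4_segments -> on_path_edge (seg_vertices u1 k4_nodes s) x' y ->
      has (fun s => on_path_edge (seg_vertices u1 k4_nodes s) x' y) k4_segments.
    by move=> si e; apply/hasP; exists s.
  have sr (s : segment H) x' : s \in k4_segments ->
      on_path_edge (nth u1 k4_nodes s.1.2 :: rcons (rev s.2) (nth u1 k4_nodes s.1.1)) x' y ->
      has (fun s => on_path_edge (seg_vertices u1 k4_nodes s) x' y) k4_segments.
    by rewrite -rE; apply: sb.
  have dx : x \in k4_nodes -> degree x = 3 by apply: deg.
  move=> xn xy; move: (dx xn) (xn) (xy).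
  rewrite !inE => d3 /or4P[] /eqP xE; rewrite xE in d3 *.
  - move/(node_edge d3 (arr sP1) (arr sQ2) (arr sL1)).
    rewrite (hn3 _ _ _ 1 3 2 _ _ _ sP1 sQ2 sL1) // => /(_ isT).
    by move=> /or3P[] e; [apply: sb sP1 e|apply: sb sQ2 e|apply: sb sL1 e].
  - move/(node_edge d3 (arris_rev (arr sP1)) (arr sQ1) (arris_rev (arr sL2))).
    rewrite (hn3 _ _ _ 0 2 3 _ _ _ sP1 sQ1 sL2) // => /(_ isT).
    by move=> /or3P[] e; [apply: sr sP1 e|apply: sb sQ1 e|apply: sr sL2 e].
  - move/(node_edge d3 (arris_rev (arr sQ1)) (arris_rev (arr sP2)) (arris_rev (arr sL1))).
    rewrite (hn3 _ _ _ 1 3 0 _ _ _ sQ1 sP2 sL1) // => /(_ isT).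
    by move=> /or3P[] e; [apply: sr sQ1 e|apply: sr sP2 e|apply: sr sL1 e].
  - move/(node_edge d3 (arris_rev (arr sQ2)) (arr sP2) (arr sL2)).
    rewrite (hn3 _ _ _ 0 2 1 _ _ _ sQ2 sP2 sL2) // => /(_ isT).
    by move=> /or3P[] e; [apply: sr sQ2 e|apply: sb sP2 e|apply: sb sL2 e].
move=> x y; rewrite mem_cat => /orP[xn|/flattenP[t /mapP[s si ->] xs]] _ xy.
  exact: node.
exact: interior si xs xy.
Qed.

End K4Skeleton.

Lemma skeleton_to_ambient (G : sgraph) (S : {set G}) (x0 : induced S)
    (nd : seq (induced S)) (sg : seq (segment (induced S))) :
  skeleton x0 nd sg ->
  skeleton (val x0) (to_ambient nd) [seq (s.1, to_ambient s.2) | s <- sg].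
Proof.
set f := fun s : segment (induced S) => (s.1, to_ambient s.2) : segment G.
case=> uV ends paths edges.
have VE : skel_vertices (to_ambient nd) [seq f s | s <- sg] = to_ambient (skel_vertices nd sg).
  rewrite /skel_vertices /to_ambient map_cat map_flatten -!map_comp; congr (_ ++ flatten _).
have svE s : (s.1.1 < size nd) && (s.1.2 < size nd) ->
    seg_vertices (val x0) (to_ambient nd) (f s) = to_ambient (seg_vertices x0 nd s).
  by case/andP=> la lb; rewrite /seg_vertices /to_ambient /= map_rcons !(nth_map x0).
split.
- by rewrite VE map_inj_uniq //; apply: val_inj.
- by rewrite all_map; apply: sub_all ends => s; rewrite /= size_map.
- apply/allP=> _ /mapP[s si ->]; rewrite svE ?(allP ends) // /to_ambient.
  by rewrite sorted_map; apply: (allP paths).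
rewrite VE => _ _ /mapP[x xV ->] /mapP[y yV ->] xy.
have /hasP[s si e] := edges x y xV yV xy.
apply/hasP; exists (f s); first exact: map_f.
rewrite svE ?(allP ends) //; case/orP: e => /infixP[t1 [t2 ->]]; apply/orP; [left|right];
  by apply/infixP; exists (to_ambient t1), (to_ambient t2); rewrite /to_ambient !map_cat.
Qed.

(** From here on lists contain interior vertices only, so their sizes are one less than the lengths
    of the arrises, and [Q1] becomes the empty list. [P2] and [L2] are reversed in order to start at
    [u4]. *)
Lemma balanced_K4_skeleton (G : sgraph) :
  contains_balanced_K4_subdivision_12 G ->
  exists (u1 u2 u3 u4 : G) (P1 Q2 P2 L1 L2 : seq G),
  [/\ skeleton u1 (k4_nodes u1 u2 u3 u4) (k4_segments P1 [::] Q2 P2 L1 L2),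
      odd (size P1 + size L1 + 3), odd (size P1 + size L2 + size Q2 + 3),
      ~~ odd (size P2 + size L2 + 3) & 0 < size L2].
Proof.
case=> S [subd [u1 [u2 [u3 [u4 [P1 [P2 [Q1 [Q2 [L1 [L2]]]]]]]]]]].
have deg h := subdivision_degree_le3 h subd.
case=> -[un degE] [aP1 aP2 aQ1 aQ2 [aL1 aL2]] [[_ o1] [_ o2]] [[_ o3] _] [q1 l2].
have dU : {in [:: u1; u2; u3; u4], forall u, degree u = 3}.
  move=> u uin; have : u \in [set u1; u2; u3; u4] by rewrite !inE -!orbA in uin *.
  by rewrite -degE inE => /eqP.
have nu i j : i < 4 -> j < 4 -> i != j ->
    nth u1 [:: u1; u2; u3; u4] i != nth u1 [:: u1; u2; u3; u4] j.
  by move=> li lj; rewrite nth_uniq.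
have [sP1 [EP1 AP1]] := is_arrisP deg (nu 0 1 isT isT isT) aP1.
have [sP2 [EP2 AP2]] := is_arrisP deg (nu 2 3 isT isT isT) aP2.
have [sQ1 [EQ1 AQ1]] := is_arrisP deg (nu 1 2 isT isT isT) aQ1.
have [sQ2 [EQ2 AQ2]] := is_arrisP deg (nu 0 3 isT isT isT) aQ2.
have [sL1 [EL1 AL1]] := is_arrisP deg (nu 0 2 isT isT isT) aL1.
have [sL2 [EL2 AL2]] := is_arrisP deg (nu 1 3 isT isT isT) aL2.
have sQ1E : sQ1 = [::].
  by move: q1; rewrite /plength EQ1 /= size_rcons; case: (sQ1).
have sk : skeleton u1 (k4_nodes u1 u2 u3 u4) (k4_segments sP1 [::] sQ2 (rev sP2) sL1 (rev sL2)).
  apply: k4_skeleton => // s; rewrite !inE.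
  case/or4P=> [| | |/or3P[]] => /eqP-> //=; rewrite -?sQ1E //; exact: arris_rev.
exists (val u1), (val u2), (val u3), (val u4).
exists (to_ambient sP1), (to_ambient sQ2), (to_ambient (rev sP2)), (to_ambient sL1), (to_ambient (rev sL2)).
have := skeleton_to_ambient sk => /= sk'; split=> //.
- move: o1; rewrite /to_ambient /close3 !size_map !size_cat !size_behead size_rev.
  by rewrite EP1 EQ1 EL1 sQ1E /= !size_rcons /=; clear; lia.
- move: o2; rewrite /to_ambient /close3 !size_map !size_cat !size_behead !size_rev.
  by rewrite EP1 EQ2 EL2 /= !size_rcons /=; clear; lia.
- move: o3; rewrite /to_ambient /close3 !size_map !size_cat !size_behead !size_rev.
  by rewrite EP2 EQ1 EL2 sQ1E /= !size_rcons /=; clear; lia.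
- by move: l2; rewrite /plength EL2 /to_ambient size_map size_rev /= size_rcons; clear; lia.
Qed.

(** * Lengths of the arrises and the three short cycles *)

Section BalancedK4.
Variables (l : nat) (G : sgraph).
Hypothesis hl : 5 <= l.
Hypothesis girth_ge : forall c : seq G, is_cycle c -> 2 * l + 1 <= size c.
Hypothesis hodd : forall c : seq G, odd_hole c -> ~~ (2 * l + 3 <= size c).
Variables (u1 u2 u3 u4 : G) (P1 Q2 P2 L1 L2 : seq G).

Let nd4 := k4_nodes u1 u2 u3 u4.
Let sg4 := k4_segments P1 [::] Q2 P2 L1 L2.
Hypothesis sk4 : skeleton u1 nd4 sg4.
Hypothesis odd1 : odd (size P1 + size L1 + 3).
Hypothesis odd2 : odd (size P1 + size L2 + size Q2 + 3).
Hypothesis even3 : ~~ odd (size P2 + size L2 + 3).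
Hypothesis L2_gt0 : 0 < size L2.

Lemma skeleton_cycle_length v sts :
    v < size nd4 -> chain sg4 v sts -> uniq (map (step_dst sg4) sts) ->
    uniq [seq st.1 | st <- sts] -> last v (map (step_dst sg4) sts) = v ->
    chordfree sg4 (visited sg4 v sts) sts -> 3 <= model_length sg4 sts ->
  exists c, [/\ is_cycle c, size c = model_length sg4 sts,
    {subset c <= skel_vertices nd4 sg4},
    {in sts, forall st, {subset seg_vertices u1 nd4 (seg_at sg4 st.1) <= c}} &
    (2 * l + 1 <= size c) /\ (odd (size c) -> size c = 2 * l + 1)].
Proof.
move=> lv ch ud us ls cf len.
have [c [cyc chl sc cU sub]] := skeleton_cycle sk4 lv ch ud us ls cf len.
exists c; split=> //; split; first exact: girth_ge.
by apply: odd_hole_size => //; apply: leq_trans hl.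
Qed.

Definition short_cycle (U s : seq G) : Prop :=
  exists c, [/\ is_cycle c, size c = 2 * l + 1, {subset c <= U} & {subset s <= c}].

(** Besides the lengths, the three cycles of length [2 * l + 1] are kept: a vertex outside the
    subdivision has at most one neighbour on each of them, and together they cover the
    subdivision. *)
Lemma balanced_lengths :
  [/\ size P1 + size L1 + 2 = 2 * l, size P1 + size L2 + size Q2 + 2 = 2 * l,
      size P1 + size P2 + size Q2 + 3 = 2 * l & l <= size P2 + 1] /\
  [/\ short_cycle (skel_vertices nd4 sg4) ([:: u1; u2; u3] ++ P1 ++ L1),
      short_cycle (skel_vertices nd4 sg4) ([:: u1; u2; u4] ++ P1 ++ L2 ++ Q2) &
      short_cycle (skel_vertices nd4 sg4) ([:: u1; u2; u3; u4] ++ P1 ++ P2 ++ Q2)].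
Proof.
have long sts : 2 < size sts -> 3 <= model_length sg4 sts.
  move=> lt; apply: leq_trans lt _; rewrite /model_length.
  by elim: sts => //= st r IHr; rewrite addSn ltnS (leq_trans IHr) ?leq_addl.
have [c1 [cyc1 sc1 U1 sub1 [_ len1]]] :=
  @skeleton_cycle_length 0 [:: (0, true); (1, true); (4, false)]
    isT isT isT isT erefl isT (long [:: (0, true); (1, true); (4, false)] isT).
have [c2 [cyc2 sc2 U2 sub2 [_ len2]]] :=
  @skeleton_cycle_length 0 [:: (0, true); (5, false); (2, false)]
    isT isT isT isT erefl isT (long [:: (0, true); (5, false); (2, false)] isT).
have [c3 [_ sc3 _ _ [len3 _]]] :=
  @skeleton_cycle_length 1 [:: (1, true); (3, false); (5, true)]
    isT isT isT isT erefl isT (long [:: (1, true); (3, false); (5, true)] isT).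
rewrite /model_length /= in sc1 sc2 sc3.
have e1 : size c1 = 2 * l + 1 by apply: len1; rewrite sc1; move: odd1; clear; lia.
have e2 : size c2 = 2 * l + 1 by apply: len2; rewrite sc2; move: odd2; clear; lia.
have L1_gt0 : 0 < size L1 by clear -sc1 sc2 e1 e2 L2_gt0; lia.
have cf5 : chordfree sg4 (visited sg4 0 [:: (0, true); (1, true); (3, false); (2, false)])
    [:: (0, true); (1, true); (3, false); (2, false)].
  by rewrite /chordfree /= L1_gt0 L2_gt0.
have [c5 [cyc5 sc5 U5 sub5 [_ len5]]] :=
  @skeleton_cycle_length 0 [:: (0, true); (1, true); (3, false); (2, false)]
    isT isT isT isT erefl cf5 (long [:: (0, true); (1, true); (3, false); (2, false)] isT).
rewrite /model_length /= in sc5.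
have e5 : size c5 = 2 * l + 1.
  by apply: len5; rewrite sc5; move: odd2 even3; clear; lia.
split; first by clear -sc1 sc2 sc3 sc5 e1 e2 e5 len3; split; lia.
have sub (sts : seq (nat * bool)) (c : seq G) : {in sts, forall st, {subset seg_vertices u1 nd4 (seg_at sg4 st.1) <= c}} ->
    {in sts, forall st, {subset (seg_at sg4 st.1).2 <= c} /\
      (nth u1 nd4 (seg_at sg4 st.1).1.1 \in c) && (nth u1 nd4 (seg_at sg4 st.1).1.2 \in c)}.
  move=> h st stin; split=> [x xs|].
    by apply: (h st stin); rewrite inE mem_rcons inE xs !orbT.
  by apply/andP; split; apply: (h st stin); rewrite !inE ?mem_rcons ?inE eqxx ?orbT.
have st_in (sts : seq (nat * bool)) k : k < size sts -> nth (0, true) sts k \in sts by apply: mem_nth.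
split.
- exists c1; split=> // x; rewrite !mem_cat !inE -!orbA.
  have S k lk := sub _ _ sub1 _ (st_in _ k lk).
  have [p1 /andP[/= i0 i1]] := S 0 isT; have [l1 /andP[/= _ i2]] := S 2 isT.
  by case/or4P=> [/eqP->|/eqP->|/eqP->|/orP[/p1|/l1]].
- exists c2; split=> // x; rewrite !mem_cat !inE -!orbA.
  have S k lk := sub _ _ sub2 _ (st_in _ k lk).
  have [p1 /andP[/= i0 i1]] := S 0 isT; have [l1 /andP[/= i3 _]] := S 1 isT.
  have [q2 _] := S 2 isT.
  by case/or4P=> [/eqP->|/eqP->|/eqP->|/or3P[/p1|/l1|/q2]].
- exists c5; split=> // x; rewrite !mem_cat !inE -!orbA.
  have S k lk := sub _ _ sub5 _ (st_in _ k lk).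
  have [p1 /andP[/= i0 i1]] := S 0 isT; have [p2 /andP[/= i3 i2]] := S 2 isT.
  have [q2 _] := S 3 isT.
  by case/or4P=> [/eqP->|/eqP->|/eqP->|/or4P[/eqP->|/p1|/p2|/q2]].
Qed.
End BalancedK4.

(** * Jumps from the middle of P2 *)

(* The model path through the given node labels, for segments with end labels
   [labs]. *)
Fixpoint route (labs : seq (nat * nat)) (v : nat) (r : seq nat) : seq (nat * bool) :=
  if r is t :: r' then
    let k := find (fun s => (s == (v, t)) || (s == (t, v))) labs in
    (k, (nth (0, 0) labs k).1 == v) :: route labs t r'
  else [::].

Section Window.
Variables (l : nat) (G : sgraph).
Hypothesis hl : 5 <= l.
Hypothesis girth_ge : forall c : seq G, is_cycle c -> 2 * l + 1 <= size c.
Hypothesis hodd : forall c : seq G, odd_hole c -> ~~ (2 * l + 3 <= size c).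
Variables (u1 u2 u3 u4 zm z zp : G) (P1 Q2 A B L1 L2 : seq G).

(* [P2] runs from [u4] through [A], [zm], [z], [zp], [B] to [u3]. Labels are
   positions in the list of nodes: 0 to 3 for [u1] to [u4], then 4, 5, 6 for
   [zm], [z], [zp]; below, 7, 8 stand for [y1], [y2] and 9 for a vertex
   subdividing a further segment. *)
Definition window_nodes : seq G := [:: u1; u2; u3; u4; zm; z; zp].
Definition window_segments : seq (segment G) :=
  [:: (0, 1, P1); (1, 2, [::]); (0, 3, Q2); (3, 4, A); (4, 5, [::]); (5, 6, [::]);
      (6, 2, B); (0, 2, L1); (3, 1, L2)].
Let U := skel_vertices window_nodes window_segments.

Hypothesis sk7 : skeleton u1 window_nodes window_segments.
Hypothesis hL1 : size P1 + size L1 + 2 = 2 * l.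
Hypothesis hL2 : size P1 + size L2 + size Q2 + 2 = 2 * l.
Hypothesis hP2 : size P1 + (size A + size B + 3) + size Q2 + 3 = 2 * l.
Hypothesis hp : l <= size A + size B + 4.
Hypothesis hAB : size A <= size B <= size A + 1.
Hypothesis C1 : short_cycle l U ([:: u1; u2; u3] ++ P1 ++ L1).
Hypothesis C2 : short_cycle l U ([:: u1; u2; u4] ++ P1 ++ L2 ++ Q2).
Hypothesis C5 : short_cycle l U ([:: u1; u2; u3; u4] ++ P1 ++ (A ++ [:: zm, z, zp & B]) ++ Q2).

Lemma one_on (s : seq G) w x y : short_cycle l U s -> w \notin U -> x \in s -> y \in s ->
  adj w x -> adj w y -> x = y.
Proof.
case=> c [cyc sc cU sc'] wU xs ys.
apply: (one_neighbour _ girth_ge cyc sc) (sc' _ xs) (sc' _ ys); first exact: leq_trans hl.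
by apply: contra wU => /cU.
Qed.

Definition full_nodes y1 y2 : seq G := [:: u1; u2; u3; u4; zm; z; zp; y1; y2].
Definition full_segments L1a L1b L2a L2b : seq (segment G) :=
  [:: (0, 1, P1); (1, 2, [::]); (0, 3, Q2); (3, 4, A); (4, 5, [::]); (5, 6, [::]);
      (6, 2, B); (0, 7, L1a); (7, 2, L1b); (3, 8, L2a); (8, 1, L2b)].
Definition full_labels : seq (nat * nat) :=
  [:: (0, 1); (1, 2); (0, 3); (3, 4); (4, 5); (5, 6); (6, 2); (0, 7); (7, 2); (3, 8); (8, 1)].

Lemma full_skeleton L1a y1 L1b L2a y2 L2b :
    L1 = L1a ++ y1 :: L1b -> L2 = L2a ++ y2 :: L2b ->
  skeleton u1 (full_nodes y1 y2) (full_segments L1a L1b L2a L2b) /\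
  skel_vertices (full_nodes y1 y2) (full_segments L1a L1b L2a L2b) =i U.
Proof.
move=> E1 E2; rewrite /U; move: sk7; rewrite /window_segments E1 E2.
set sA := [:: (0, 1, P1); (1, 2, [::]); (0, 3, Q2); (3, 4, A); (4, 5, [::]); (5, 6, [::]); (6, 2, B)].
move=> sk; have sk' := @skeleton_subdivide _ _ _ sA 0 2 L1a y1 L1b _ sk.
have sk'' := @skeleton_subdivide _ _ _ (sA ++ [:: (0, 7, L1a); (7, 2, L1b)]) 3 1 L2a y2 L2b [::] sk'.
split=> // x.
have := perm_mem (@skel_vertices_subdivide _ (rcons window_nodes y1) (sA ++ [:: (0, 7, L1a); (7, 2, L1b)]) 3 1 L2a y2 L2b [::]) x.
have := perm_mem (@skel_vertices_subdivide _ window_nodes sA 0 2 L1a y1 L1b [:: (3, 1, L2a ++ y2 :: L2b)]) x.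
by move=> /= h1 h2; rewrite -h1 -h2.
Qed.

(* When [w] has no neighbour on [L1], any vertex of [L1] may serve as [y1], and
   similarly for [y2], so that a single skeleton covers all cases. *)
Lemma neighbours_on_L1_L2 w : w \notin U ->
  exists L1a y1 L1b L2a y2 L2b,
  [/\ L1 = L1a ++ y1 :: L1b, L2 = L2a ++ y2 :: L2b,
      {in L1, forall x, adj w x -> x = y1} & {in L2, forall x, adj w x -> x = y2}].
Proof.
move=> wU.
have pick (s t : seq G) : 0 < size s -> short_cycle l U t -> {subset s <= t} ->
    exists sa y sb, s = sa ++ y :: sb /\ {in s, forall x, adj w x -> x = y}.
  move=> s0 ct st; have [/hasP[y ys wy]|/hasPn no] := boolP (has (adj w) s).
    have [sa [sb sE]] := mem_split ys; exists sa, y, sb; split=> // x xs wx.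
    exact: (one_on ct wU (st _ xs) (st _ ys)).
  case: s s0 no {st} => // y s _ no; exists [::], y, s; split=> // x xs wx.
  by have := no x xs; rewrite wx.
have [||L1a [y1 [L1b [E1 n1]]]] := pick L1 _ _ C1.
- by move: hL1 hP2 hp; clear; lia.
- by move=> x xs; rewrite !mem_cat xs !orbT.
have [||L2a [y2 [L2b [E2 n2]]]] := pick L2 _ _ C2.
- by move: hL2 hP2 hp; clear; lia.
- by move=> x xs; rewrite !mem_cat xs !orbT.
by exists L1a, y1, L1b, L2a, y2, L2b.
Qed.

Lemma U_split x : x \in U ->
  [|| x \in L1, x \in L2 | x \in [:: u1; u2; u3; u4] ++ P1 ++ (A ++ [:: zm, z, zp & B]) ++ Q2].
Proof.
rewrite /U /skel_vertices /= !(mem_cat, inE) -!orbA /= orbF.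
by do ?[case/orP=> [->|]; rewrite ?orbT //]; move=> ->; rewrite ?orbT.
Qed.

Section Jump.
Variable W : seq G.
Hypothesis iW : induced_path W.
Hypothesis W0 : 0 < size W.
Hypothesis WU : {in W, forall w, w \notin U}.
Let w := last u1 W.

Lemma last_in_W : w \in W.
Proof. by rewrite /w; case: (W) W0 => //= x s _; apply: mem_last. Qed.

Lemma jump_from nd sg v (Y E : seq nat) :
    skeleton u1 nd sg -> skel_vertices nd sg =i U ->
    {in W, forall x, {in U, forall y, adj x y ->
      [\/ x = head u1 W /\ y = nth u1 nd v, x = w /\ y \in [seq nth u1 nd m | m <- Y] |
          y \in [seq nth u1 nd m | m <- E]]}} ->
    adj (nth u1 nd v) (head u1 W) ->
  forall t sts, adj w (nth u1 nd t) -> model_path nd sg v t sts ->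
    all (fun m => (m < size nd) && ((m == t) || (m \notin visited sg v sts))) Y ->
    all (fun m => (m < size nd) && (m \notin visited sg v sts)) E ->
    chordfree sg (visited sg v sts) sts ->
  2 * l + 1 <= size W + (model_length sg sts).+1 /\
  (odd (size W + (model_length sg sts).+1) ->
   size W + (model_length sg sts).+1 = 2 * l + 1).
Proof.
move=> sk VU att ev t sts wt mp YP EP cf.
apply: (jump_length sk girth_ge hodd (leq_trans _ hl) iW W0 _ _ ev _ mp YP EP cf) => //.
- by move=> x xW; rewrite VU; apply: WU.
- by move=> x xW y; rewrite VU; apply: att.
- by rewrite adj_sym.
Qed.

End Jump.

Lemma induced_path1 (x : G) : induced_path [:: x].
Proof. by split=> // y y'; rewrite !inE => /eqP-> /eqP->; rewrite adj_irrefl. Qed.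

(** The case of a jump through a single outer vertex [x] with two neighbours on the skeleton; it
    supplies the holes that pass through the last vertex of a longer jump without using the rest of
    it. *)
Lemma jump_at nd sg v t sts x (E : seq nat) :
    skeleton u1 nd sg -> skel_vertices nd sg =i U -> x \notin U ->
    {in U, forall y, adj x y ->
      y \in [seq nth u1 nd m | m <- [:: v; t]] ++ [seq nth u1 nd m | m <- E]} ->
    adj x (nth u1 nd v) -> adj x (nth u1 nd t) -> model_path nd sg v t sts ->
    all (fun m => (m < size nd) && (m \notin visited sg v sts)) E ->
    chordfree sg (visited sg v sts) sts ->
  2 * l + 1 <= (model_length sg sts).+2 /\
  (odd (model_length sg sts).+2 -> (model_length sg sts).+2 = 2 * l + 1).
Proof.
move=> sk VU xU att xv xt mp EP cf.
apply: (@jump_from [:: x] _ _ _ nd sg v [:: t] E sk VU _ _ t sts xt mp _ EP cf) => //.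
- exact: induced_path1.
- by move=> y; rewrite inE => /eqP->.
- move=> _ /[!inE] /eqP-> y yU xy; have := att y yU xy; rewrite mem_cat !inE -orbA.
  case/or3P=> [/eqP yv|yt|yE]; [by constructor 1|by constructor 2; split; rewrite ?inE|].
  by constructor 3.
- by rewrite adj_sym.
- suff lt : t < size nd by rewrite /= lt eqxx.
  case/andP: mp => lv /and5P[ch _ _ /eqP <- _].
  have := step_dst_lt sk; have := chain_lt ch; clear -lv.
  elim: sts v lv => [|st r IHr] v lv //= ltr ltd.
  apply: (IHr (step_dst sg st)) => //; first by apply: ltd; apply: ltr; rewrite inE eqxx.
  by move=> st' st'r; apply: ltr; rewrite inE st'r orbT.
Qed.

Ltac chordfree_done :=
  rewrite /chordfree /=;
  repeat match goal with H : is_true ((0 < _) && (0 < _)) |- _ => case/andP: H => ? ? end;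
  repeat match goal with H : is_true (0 < _) |- _ => rewrite ?H; clear H end; done.

(** The labels of a route are concrete, so its being a path and its avoiding the other attachments
    are decided by computation. Chordlessness still depends on which segments have an interior. *)
Ltac jump_fact J labs v r wt nm :=
  let t := eval vm_compute in (last 0 r) in
  let sts := eval vm_compute in (route labs v r) in
  have nm := J t sts wt isT isT;
  match type of nm with
    ?C -> _ => let h := fresh in assert (h : C) by chordfree_done; specialize (nm h); clear h
  end; rewrite /model_length /= in nm.

(** [C] states that certain segments, which would be chords if they were single edges, have interior
    vertices. It stays as a premise, for the arithmetic to settle. *)
Ltac jump_fact_if C J labs v r wt nm :=
  let t := eval vm_compute in (last 0 r) in
  let sts := eval vm_compute in (route labs v r) in
  pose proof (fun c : is_true C => J t sts wt isT isT ltac:(chordfree_done)) as nm;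
  rewrite /model_length /= in nm.

Ltac jump_at_fact J labs v r nm :=
  let sts := eval vm_compute in (route labs v r) in
  have nm := J sts isT isT;
  match type of nm with
    ?C -> _ => let h := fresh in assert (h : C) by chordfree_done; specialize (nm h); clear h
  end; rewrite /model_length /= in nm.

Ltac jump_at_fact_if C J labs v r nm :=
  let sts := eval vm_compute in (route labs v r) in
  pose proof (fun c : is_true C => J sts isT isT ltac:(chordfree_done)) as nm;
  rewrite /model_length /= in nm.

(** * Jumps from z to attachments other than zm, z and zp *)

Section FarJump.
Variable W : seq G.
Hypothesis iW : induced_path W.
Hypothesis W0 : 0 < size W.
Hypothesis WU : {in W, forall w, w \notin U}.
Let w := last u1 W.
Hypothesis ev : adj z (head u1 W).
Hypothesis att : {in W, forall x, {in U, forall y, adj x y ->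
  (x = head u1 W /\ y = z) \/ (x = w /\ y \notin [:: zm; z; zp])}}.

Let wU : w \notin U.
Proof. by apply: WU; apply: last_in_W. Qed.

(* An induced path of the skeleton from [z] to an attachment of [w] that avoids
   the other attachments closes up with [W] to a hole. Paths of both parities
   and of different lengths are then incompatible with the constraint that odd
   holes have length [2 * l + 1] and all cycles are at least that long. *)
Lemma far_jump nd sg (Y : seq nat) :
    skeleton u1 nd sg -> skel_vertices nd sg =i U -> nth u1 nd 5 = z ->
    {in U, forall x, adj w x -> x \notin [:: zm; z; zp] -> x \in [seq nth u1 nd m | m <- Y]} ->
  forall t sts, adj w (nth u1 nd t) -> model_path nd sg 5 t sts ->
    all (fun m => (m < size nd) && ((m == t) || (m \notin visited sg 5 sts))) Y ->
    chordfree sg (visited sg 5 sts) sts ->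
  2 * l + 1 <= size W + (model_length sg sts).+1 /\
  (odd (size W + (model_length sg sts).+1) ->
   size W + (model_length sg sts).+1 = 2 * l + 1).
Proof.
move=> sk VU z5 onY t sts wt mp YP cf.
apply: (@jump_from W iW W0 WU nd sg 5 Y [::] sk VU _ _ t sts wt mp YP _ cf) => //.
  move=> x xW y yU xy; rewrite z5; case: (att xW yU xy) => [h|[xw yn]]; first by constructor 1.
  by constructor 2; split=> //; apply: onY => //; rewrite -xw.
by rewrite z5.
Qed.

Lemma far_window x : x \in U -> adj w x -> x \in [:: zm; z; zp] -> x = z.
Proof.
by move=> xU wx xz; case: (att (last_in_W W0) xU wx) => [[]//|[_]]; rewrite xz.
Qed.

Section Attachments.
Variables (L1a L1b L2a L2b : seq G) (y1 y2 : G).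
Hypothesis E1 : L1 = L1a ++ y1 :: L1b.
Hypothesis E2 : L2 = L2a ++ y2 :: L2b.

Let s1 : size L1 = (size L1a + (size L1b).+1)%N.
Proof. by rewrite E1 size_cat. Qed.
Let s2 : size L2 = (size L2a + (size L2b).+1)%N.
Proof. by rewrite E2 size_cat. Qed.

Ltac arith := move: hl hL1 hL2 hP2 hp hAB W0 s1 s2.

Definition attached_in (s : seq G) : Prop :=
  {in U, forall x, adj w x -> x \notin [:: zm; z; zp] -> x \in s}.

(** The routes of [e1] and [e2], and likewise of [e3] and [e4], differ by the two ways round the odd
    cycle P1 L2 Q2, hence in parity, while [e1] and [e3] agree in parity. If [e2] and [e4] were odd,
    their lengths would add up to more than [4 * l + 2]. If [e1] is odd then so is [e5], which is
    strictly longer. The cases in which [y2] is next to [u4] or [u2] fall to the lower bounds. *)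
Lemma no_far_jump_y2 : adj w y2 -> attached_in [:: y2] -> False.
Proof.
move=> w2 onY; have [sk VU] := full_skeleton E1 E2.
have J := @far_jump _ _ [:: 8] sk VU erefl onY.
jump_fact J full_labels 5 [:: 4; 3; 8] w2 e1.
jump_fact J full_labels 5 [:: 6; 2; 1; 8] w2 e3.
jump_fact_if (0 < size L2a) J full_labels 5 [:: 4; 3; 0; 1; 8] w2 e2.
jump_fact_if (0 < size L2b) J full_labels 5 [:: 6; 2; 1; 0; 3; 8] w2 e4.
jump_fact J full_labels 5 [:: 6; 2; 7; 0; 3; 8] w2 e5.
by clear J; arith; move: e1 e2 e3 e4 e5; clear; lia.
Qed.

Lemma no_far_jump_y1 : adj w y1 -> attached_in [:: y1] -> False.
Proof.
move=> w1 onY; have [sk VU] := full_skeleton E1 E2.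
have J := @far_jump _ _ [:: 7] sk VU erefl onY.
jump_fact J full_labels 5 [:: 6; 2; 7] w1 f1.
jump_fact J full_labels 5 [:: 4; 3; 0; 7] w1 f3.
jump_fact_if (0 < size L1b) J full_labels 5 [:: 6; 2; 1; 0; 7] w1 f2.
jump_fact_if (0 < size L1a) J full_labels 5 [:: 4; 3; 0; 1; 2; 7] w1 f4.
jump_fact J full_labels 5 [:: 4; 3; 8; 1; 2; 7] w1 g1.
jump_fact_if (0 < size Q2) J full_labels 5 [:: 4; 3; 8; 1; 0; 7] w1 g2.
by clear J; arith; move: f1 f2 f3 f4 g1 g2; clear; lia.
Qed.

Lemma no_far_jump_y1_y2 : adj w y1 -> adj w y2 -> attached_in [:: y1; y2] -> False.
Proof.
move=> w1 w2 onY; have [sk VU] := full_skeleton E1 E2.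
have J := @far_jump _ _ [:: 7; 8] sk VU erefl onY.
have attw : {in U, forall y, adj w y -> y \in [:: y1; y2] ++ [:: z]}.
  move=> y yU wy; rewrite mem_cat; have [yn|yn] := boolP (y \in [:: zm; z; zp]).
    by rewrite (far_window yU wy yn) mem_head orbT.
  by rewrite (onY y).
have Jw sts := @jump_at _ _ 7 8 sts _ [:: 5] sk VU wU attw w1 w2.
jump_fact J full_labels 5 [:: 4; 3; 8] w2 e1.
jump_fact J full_labels 5 [:: 6; 2; 1; 8] w2 e3.
jump_fact_if (0 < size L2a) J full_labels 5 [:: 4; 3; 0; 1; 8] w2 e2.
jump_fact_if (0 < size L2b) J full_labels 5 [:: 6; 2; 1; 0; 3; 8] w2 e4.
jump_fact J full_labels 5 [:: 6; 2; 7] w1 f1.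
jump_fact J full_labels 5 [:: 4; 3; 0; 7] w1 f3.
jump_fact_if (0 < size L1b) J full_labels 5 [:: 6; 2; 1; 0; 7] w1 f2.
jump_fact_if (0 < size L1a) J full_labels 5 [:: 4; 3; 0; 1; 2; 7] w1 f4.
jump_at_fact Jw full_labels 7 [:: 0; 1; 8] g1.
jump_at_fact_if ((0 < size L1a) && (0 < size L2b)) Jw full_labels 7 [:: 2; 1; 0; 3; 8] g2.
(* The routes to [y2] leave only the case in which [e1] and [e3] are both odd, hence both
   [2 * l + 1]; this determines the position of [y2] and the size of [W]. The routes to [y1] and the
   cycles closed by [w] alone are incompatible with these values. *)
have [j1 j2] : size L2a = size B + 2 /\ size W + 1 + (size A + size B + 4) = 2 * l.
  by clear J Jw; arith; move: e1 e2 e3 e4; clear; lia.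
by clear J Jw; arith; move: j1 j2 f1 f2 f3 f4 g1 g2; clear; lia.
Qed.
Let full_seg := full_segments L1a L1b L2a L2b.

Definition P1_segments (sa sb : seq G) : seq (segment G) :=
      [:: (0, 9, sa); (9, 1, sb); (1, 2, [::]); (0, 3, Q2); (3, 4, A); (4, 5, [::]); (5, 6,
      [::]); (6, 2, B); (0, 7, L1a); (7, 2, L1b); (3, 8, L2a); (8, 1, L2b)].
Definition P1_labels : seq (nat * nat) :=
      [:: (0, 9); (9, 1); (1, 2); (0, 3); (3, 4); (4, 5); (5, 6); (6, 2); (0, 7); (7, 2); (3,
      8); (8, 1)].

Lemma P1_skeleton sa y sb : P1 = sa ++ y :: sb ->
  skeleton u1 (rcons (full_nodes y1 y2) y) (P1_segments sa sb) /\
  skel_vertices (rcons (full_nodes y1 y2) y) (P1_segments sa sb) =i U.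
Proof.
move=> E; have [+ VU] := full_skeleton E1 E2.
have := @skel_vertices_subdivide _ (full_nodes y1 y2) (take 0 full_seg) 0 1 sa y sb (drop 1 full_seg).
rewrite /full_seg /full_segments /= -E => pm sk; split.
  have := @skeleton_subdivide _ _ (full_nodes y1 y2) (take 0 full_seg) 0 1 sa y sb (drop 1 full_seg).
  by rewrite /full_seg /full_segments /= -E; apply.
by move=> x; rewrite -VU -(perm_mem pm).
Qed.

Definition Q2_segments (sa sb : seq G) : seq (segment G) :=
      [:: (0, 1, P1); (1, 2, [::]); (0, 9, sa); (9, 3, sb); (3, 4, A); (4, 5, [::]); (5, 6,
      [::]); (6, 2, B); (0, 7, L1a); (7, 2, L1b); (3, 8, L2a); (8, 1, L2b)].
Definition Q2_labels : seq (nat * nat) :=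
      [:: (0, 1); (1, 2); (0, 9); (9, 3); (3, 4); (4, 5); (5, 6); (6, 2); (0, 7); (7, 2); (3,
      8); (8, 1)].

Lemma Q2_skeleton sa y sb : Q2 = sa ++ y :: sb ->
  skeleton u1 (rcons (full_nodes y1 y2) y) (Q2_segments sa sb) /\
  skel_vertices (rcons (full_nodes y1 y2) y) (Q2_segments sa sb) =i U.
Proof.
move=> E; have [+ VU] := full_skeleton E1 E2.
have := @skel_vertices_subdivide _ (full_nodes y1 y2) (take 2 full_seg) 0 3 sa y sb (drop 3 full_seg).
rewrite /full_seg /full_segments /= -E => pm sk; split.
  have := @skeleton_subdivide _ _ (full_nodes y1 y2) (take 2 full_seg) 0 3 sa y sb (drop 3 full_seg).
  by rewrite /full_seg /full_segments /= -E; apply.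
by move=> x; rewrite -VU -(perm_mem pm).
Qed.

Definition A_segments (sa sb : seq G) : seq (segment G) :=
      [:: (0, 1, P1); (1, 2, [::]); (0, 3, Q2); (3, 9, sa); (9, 4, sb); (4, 5, [::]); (5, 6,
      [::]); (6, 2, B); (0, 7, L1a); (7, 2, L1b); (3, 8, L2a); (8, 1, L2b)].
Definition A_labels : seq (nat * nat) :=
      [:: (0, 1); (1, 2); (0, 3); (3, 9); (9, 4); (4, 5); (5, 6); (6, 2); (0, 7); (7, 2); (3,
      8); (8, 1)].

Lemma A_skeleton sa y sb : A = sa ++ y :: sb ->
  skeleton u1 (rcons (full_nodes y1 y2) y) (A_segments sa sb) /\
  skel_vertices (rcons (full_nodes y1 y2) y) (A_segments sa sb) =i U.
Proof.
move=> E; have [+ VU] := full_skeleton E1 E2.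
have := @skel_vertices_subdivide _ (full_nodes y1 y2) (take 3 full_seg) 3 4 sa y sb (drop 4 full_seg).
rewrite /full_seg /full_segments /= -E => pm sk; split.
  have := @skeleton_subdivide _ _ (full_nodes y1 y2) (take 3 full_seg) 3 4 sa y sb (drop 4 full_seg).
  by rewrite /full_seg /full_segments /= -E; apply.
by move=> x; rewrite -VU -(perm_mem pm).
Qed.

Definition B_segments (sa sb : seq G) : seq (segment G) :=
      [:: (0, 1, P1); (1, 2, [::]); (0, 3, Q2); (3, 4, A); (4, 5, [::]); (5, 6, [::]); (6, 9,
      sa); (9, 2, sb); (0, 7, L1a); (7, 2, L1b); (3, 8, L2a); (8, 1, L2b)].
Definition B_labels : seq (nat * nat) :=
      [:: (0, 1); (1, 2); (0, 3); (3, 4); (4, 5); (5, 6); (6, 9); (9, 2); (0, 7); (7, 2); (3,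
      8); (8, 1)].

Lemma B_skeleton sa y sb : B = sa ++ y :: sb ->
  skeleton u1 (rcons (full_nodes y1 y2) y) (B_segments sa sb) /\
  skel_vertices (rcons (full_nodes y1 y2) y) (B_segments sa sb) =i U.
Proof.
move=> E; have [+ VU] := full_skeleton E1 E2.
have := @skel_vertices_subdivide _ (full_nodes y1 y2) (take 6 full_seg) 6 2 sa y sb (drop 7 full_seg).
rewrite /full_seg /full_segments /= -E => pm sk; split.
  have := @skeleton_subdivide _ _ (full_nodes y1 y2) (take 6 full_seg) 6 2 sa y sb (drop 7 full_seg).
  by rewrite /full_seg /full_segments /= -E; apply.
by move=> x; rewrite -VU -(perm_mem pm).
Qed.

Lemma no_far_jump_u1 : adj w u1 -> attached_in [:: u1] -> False.
Proof.
move=> w0 onY; have [sk VU] := full_skeleton E1 E2.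
have J := @far_jump _ _ [:: 0] sk VU erefl onY.
jump_fact J full_labels 5 [:: 4; 3; 0] w0 e1.
jump_fact J full_labels 5 [:: 6; 2; 1; 0] w0 e2.
jump_fact_if (0 < size Q2) J full_labels 5 [:: 4; 3; 8; 1; 0] w0 e3.
jump_fact J full_labels 5 [:: 6; 2; 7; 0] w0 e4.
by clear J; arith; move: e1 e2 e3 e4; clear; lia.
Qed.

Lemma no_far_jump_u2 : adj w u2 -> attached_in [:: u2] -> False.
Proof.
move=> w0 onY; have [sk VU] := full_skeleton E1 E2.
have J := @far_jump _ _ [:: 1] sk VU erefl onY.
jump_fact J full_labels 5 [:: 4; 3; 0; 1] w0 e1.
jump_fact J full_labels 5 [:: 6; 2; 1] w0 e2.
jump_fact J full_labels 5 [:: 4; 3; 8; 1] w0 e3.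
by clear J; arith; move: e1 e2 e3; clear; lia.
Qed.

(** The short cycles through [u3] cover everything but the interior of [L2], so [y2] may be a second
    neighbour of [w] and the routes keep off [L2]. The roles of [L1] and [L2] are exchanged for
    [u4]. *)
Lemma no_far_jump_u3 : adj w u3 -> attached_in [:: u3; y2] -> False.
Proof.
move=> w0 onY; have [sk VU] := full_skeleton E1 E2.
have J := @far_jump _ _ [:: 2; 8] sk VU erefl onY.
jump_fact J full_labels 5 [:: 6; 2] w0 e1.
jump_fact J full_labels 5 [:: 4; 3; 0; 1; 2] w0 e2.
jump_fact J full_labels 5 [:: 4; 3; 0; 7; 2] w0 e3.
by clear J; arith; move: e1 e2 e3; clear; lia.
Qed.

Lemma no_far_jump_u4 : adj w u4 -> attached_in [:: u4; y1] -> False.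
Proof.
move=> w0 onY; have [sk VU] := full_skeleton E1 E2.
have J := @far_jump _ _ [:: 3; 7] sk VU erefl onY.
jump_fact J full_labels 5 [:: 4; 3] w0 e1.
jump_fact J full_labels 5 [:: 6; 2; 1; 0; 3] w0 e2.
jump_fact J full_labels 5 [:: 6; 2; 1; 8; 3] w0 e3.
by clear J; arith; move: e1 e2 e3; clear; lia.
Qed.

Lemma no_far_jump_P1 y : y \in P1 -> adj w y -> attached_in [:: y] -> False.
Proof.
case/mem_split=> sa [sb E] w0 onY; have [sk VU] := P1_skeleton E.
have s0 : size P1 = (size sa + (size sb).+1)%N by rewrite E size_cat.
have J := @far_jump _ _ [:: 9] sk VU erefl onY.
jump_fact J P1_labels 5 [:: 4; 3; 0; 9] w0 e1.
jump_fact J P1_labels 5 [:: 6; 2; 1; 9] w0 e2.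
jump_fact J P1_labels 5 [:: 4; 3; 8; 1; 9] w0 e3.
jump_fact J P1_labels 5 [:: 6; 2; 7; 0; 9] w0 e4.
by clear J; arith; move: s0 e1 e2 e3 e4; clear; lia.
Qed.

Lemma no_far_jump_Q2 y : y \in Q2 -> adj w y -> attached_in [:: y; y1] -> False.
Proof.
case/mem_split=> sa [sb E] w0 onY; have [sk VU] := Q2_skeleton E.
have s0 : size Q2 = (size sa + (size sb).+1)%N by rewrite E size_cat.
have J := @far_jump _ _ [:: 9; 7] sk VU erefl onY.
jump_fact J Q2_labels 5 [:: 4; 3; 9] w0 e1.
jump_fact J Q2_labels 5 [:: 6; 2; 1; 0; 9] w0 e2.
jump_fact_if (0 < size sb) J Q2_labels 5 [:: 4; 3; 8; 1; 0; 9] w0 e3.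
jump_fact J Q2_labels 5 [:: 6; 2; 1; 8; 3; 9] w0 e4.
by clear J; arith; move: s0 e1 e2 e3 e4; clear; lia.
Qed.

(** [A] lies on only one of the three short cycles, so [y1] and [y2] may both be further neighbours
    of [w]. If one of them is not, routes may run through its arris; if both are, [w] closes a hole
    [g1] with the route between them. *)
Lemma no_far_jump_A y : y \in A -> adj w y -> attached_in [:: y; y1; y2] -> False.
Proof.
case/mem_split=> sa [sb E] w0 onY; have [sk VU] := A_skeleton E.
have s0 : size A = (size sa + (size sb).+1)%N by rewrite E size_cat.
have [w1|w1] := boolP (adj w y1); last first.
  have onY' : attached_in [:: y; y2].
    move=> x xU wx xn; have := onY x xU wx xn; rewrite !inE.
    case/or3P=> [->|/eqP xE|->]; rewrite ?orbT //.
    by rewrite -xE wx in w1.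
  have J := @far_jump _ _ [:: 9; 8] sk VU erefl onY'.
  jump_fact J A_labels 5 [:: 4; 9] w0 e1.
  jump_fact J A_labels 5 [:: 6; 2; 1; 0; 3; 9] w0 e2.
  jump_fact J A_labels 5 [:: 6; 2; 7; 0; 3; 9] w0 e3.
  by clear J; arith; move: s0 e1 e2 e3; clear; lia.
have [w2|w2] := boolP (adj w y2); last first.
  have onY' : attached_in [:: y; y1].
    move=> x xU wx xn; have := onY x xU wx xn; rewrite !inE.
    case/or3P=> [->|->|/eqP xE]; rewrite ?orbT //.
    by rewrite -xE wx in w2.
  have J := @far_jump _ _ [:: 9; 7] sk VU erefl onY'.
  jump_fact J A_labels 5 [:: 4; 9] w0 e1.
  jump_fact J A_labels 5 [:: 6; 2; 1; 0; 3; 9] w0 e2.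
  jump_fact J A_labels 5 [:: 6; 2; 1; 8; 3; 9] w0 e3.
  by clear J; arith; move: s0 e1 e2 e3; clear; lia.
have J := @far_jump _ _ [:: 9; 7; 8] sk VU erefl onY.
have attw : {in U, forall x, adj w x -> x \in [:: y1; y2] ++ [:: z; y]}.
  move=> x xU wx; rewrite mem_cat; have [xn|xn] := boolP (x \in [:: zm; z; zp]).
    by rewrite (far_window xU wx xn) mem_head orbT.
  by have := onY x xU wx xn; rewrite !inE => /or3P[]->; rewrite ?orbT.
have Jw sts := @jump_at _ _ 7 8 sts _ [:: 5; 9] sk VU wU attw w1 w2.
jump_fact J A_labels 5 [:: 4; 9] w0 e1.
jump_fact J A_labels 5 [:: 6; 2; 1; 0; 3; 9] w0 e2.
jump_fact J A_labels 5 [:: 6; 2; 1; 8] w2 f1.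
jump_fact_if (0 < size L2b) J A_labels 5 [:: 6; 2; 1; 0; 3; 8] w2 f2.
jump_fact J A_labels 5 [:: 6; 2; 7] w1 f3.
jump_fact_if (0 < size L1b) J A_labels 5 [:: 6; 2; 1; 0; 7] w1 f4.
jump_at_fact Jw A_labels 7 [:: 2; 1; 8] g1.
by clear J Jw; arith; move: s0 e1 e2 f1 f2 f3 f4 g1; clear; lia.
Qed.

Lemma no_far_jump_B y : y \in B -> adj w y -> attached_in [:: y; y1; y2] -> False.
Proof.
case/mem_split=> sa [sb E] w0 onY; have [sk VU] := B_skeleton E.
have s0 : size B = (size sa + (size sb).+1)%N by rewrite E size_cat.
have [w1|w1] := boolP (adj w y1); last first.
  have onY' : attached_in [:: y; y2].
    move=> x xU wx xn; have := onY x xU wx xn; rewrite !inE.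
    case/or3P=> [->|/eqP xE|->]; rewrite ?orbT //.
    by rewrite -xE wx in w1.
  have J := @far_jump _ _ [:: 9; 8] sk VU erefl onY'.
  jump_fact J B_labels 5 [:: 6; 9] w0 e1.
  jump_fact J B_labels 5 [:: 4; 3; 0; 1; 2; 9] w0 e2.
  jump_fact J B_labels 5 [:: 4; 3; 0; 7; 2; 9] w0 e3.
  by clear J; arith; move: s0 e1 e2 e3; clear; lia.
have [w2|w2] := boolP (adj w y2); last first.
  have onY' : attached_in [:: y; y1].
    move=> x xU wx xn; have := onY x xU wx xn; rewrite !inE.
    case/or3P=> [->|->|/eqP xE]; rewrite ?orbT //.
    by rewrite -xE wx in w2.
  have J := @far_jump _ _ [:: 9; 7] sk VU erefl onY'.
  jump_fact J B_labels 5 [:: 6; 9] w0 e1.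
  jump_fact J B_labels 5 [:: 4; 3; 0; 1; 2; 9] w0 e2.
  jump_fact J B_labels 5 [:: 4; 3; 8; 1; 2; 9] w0 e3.
  by clear J; arith; move: s0 e1 e2 e3; clear; lia.
have J := @far_jump _ _ [:: 9; 7; 8] sk VU erefl onY.
have attw : {in U, forall x, adj w x -> x \in [:: y1; y2] ++ [:: z; y]}.
  move=> x xU wx; rewrite mem_cat; have [xn|xn] := boolP (x \in [:: zm; z; zp]).
    by rewrite (far_window xU wx xn) mem_head orbT.
  by have := onY x xU wx xn; rewrite !inE => /or3P[]->; rewrite ?orbT.
have Jw sts := @jump_at _ _ 7 8 sts _ [:: 5; 9] sk VU wU attw w1 w2.
jump_fact J B_labels 5 [:: 6; 9] w0 e1.
jump_fact J B_labels 5 [:: 4; 3; 0; 1; 2; 9] w0 e2.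
jump_fact J B_labels 5 [:: 4; 3; 8] w2 f1.
jump_fact_if (0 < size L2a) J B_labels 5 [:: 4; 3; 0; 1; 8] w2 f2.
jump_fact J B_labels 5 [:: 4; 3; 0; 7] w1 f3.
jump_fact_if (0 < size L1a) J B_labels 5 [:: 4; 3; 0; 1; 2; 7] w1 f4.
jump_at_fact Jw B_labels 7 [:: 0; 3; 8] g1.
by clear J Jw; arith; move: s0 e1 e2 f1 f2 f3 f4 g1; clear; lia.
Qed.

End Attachments.
Let C5s := [:: u1; u2; u3; u4] ++ P1 ++ (A ++ [:: zm, z, zp & B]) ++ Q2.

(** The cases follow the neighbour [y0] of [w] on P1 Q1 P2 Q2 outside the window, if there is one.
    The more short cycles pass through [y0], the fewer other attachments remain: none if it is on P1
    or one of its ends, one on L2 for [u3], one on L1 for [u4] and [Q2], and one on each for [A] and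
    [B]. *)
Lemma no_far_jump y : y \in U -> adj w y -> y \notin [:: zm; z; zp] -> False.
Proof.
move=> yU wy yn.
have [L1a [y1 [L1b [L2a [y2 [L2b [E1 E2 n1 n2]]]]]]] := neighbours_on_L1_L2 wU.
have [/hasP[y0 y0C /andP[w0 y0n]]|/hasPn noC] :=
  boolP (has (fun x => adj w x && (x \notin [:: zm; z; zp])) C5s); last first.
  have on : attached_in [:: y1; y2].
    move=> x xU wx xn; case/or3P: (U_split xU) => [x1|x2|xC].
    - by rewrite (n1 x x1 wx) mem_head.
    - by rewrite (n2 x x2 wx) !inE eqxx orbT.
    - by have := noC x xC; rewrite wx xn.
  have [w1|w1] := boolP (adj w y1); have [w2|w2] := boolP (adj w y2).
  - exact: (no_far_jump_y1_y2 E1 E2).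
  - apply: (no_far_jump_y1 E1 E2 w1) => x xU wx xn.
    have := on x xU wx xn; rewrite !inE => /orP[//|/eqP xE].
    by rewrite -xE wx in w2.
  - apply: (no_far_jump_y2 E1 E2 w2) => x xU wx xn.
    have := on x xU wx xn; rewrite !inE => /orP[/eqP xE|//].
    by rewrite -xE wx in w1.
  - have := on y yU wy yn; rewrite !inE => /orP[] /eqP yE.
      by rewrite -yE wy in w1.
    by rewrite -yE wy in w2.
have on : attached_in [:: y0; y1; y2].
  move=> x xU wx xn; case/or3P: (U_split xU) => [x1|x2|xC].
  - by rewrite (n1 x x1 wx) !inE eqxx orbT.
  - by rewrite (n2 x x2 wx) !inE eqxx !orbT.
  - by rewrite (one_on C5 wU xC y0C wx w0) mem_head.
have only1 : y0 \in [:: u1; u2; u3] ++ P1 ++ L1 -> attached_in [:: y0; y2].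
  move=> y01 x xU wx xn; case/or3P: (U_split xU) => [x1|x2|xC].
  - by rewrite (one_on C1 wU _ y01 wx w0) ?mem_head // !mem_cat x1 !orbT.
  - by rewrite (n2 x x2 wx) !inE eqxx orbT.
  - by rewrite (one_on C5 wU xC y0C wx w0) mem_head.
have only2 : y0 \in [:: u1; u2; u4] ++ P1 ++ L2 ++ Q2 -> attached_in [:: y0; y1].
  move=> y02 x xU wx xn; case/or3P: (U_split xU) => [x1|x2|xC].
  - by rewrite (n1 x x1 wx) !inE eqxx orbT.
  - by rewrite (one_on C2 wU _ y02 wx w0) ?mem_head // !mem_cat x2 !orbT.
  - by rewrite (one_on C5 wU xC y0C wx w0) mem_head.
have only12 : y0 \in [:: u1; u2] ++ P1 -> attached_in [:: y0].
  rewrite mem_cat => y012 x xU wx xn; case/or3P: (U_split xU) => [x1|x2|xC].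
  - rewrite (one_on C1 wU _ _ wx w0) ?mem_head // !mem_cat ?x1 ?orbT // !inE.
    by move: y012; rewrite !inE -!orbA => /or3P[]->; rewrite ?orbT.
  - rewrite (one_on C2 wU _ _ wx w0) ?mem_head // !mem_cat ?x2 ?orbT // !inE.
    by move: y012; rewrite !inE -!orbA => /or3P[]->; rewrite ?orbT.
  - by rewrite (one_on C5 wU xC y0C wx w0) mem_head.
move: y0C y0n; rewrite !(mem_cat, inE) -!orbA.
case/or4P=> [/eqP y0E|/eqP y0E|/eqP y0E|/or4P[/eqP y0E|y0P1|y0A|]].
- by move=> _; apply: (no_far_jump_u1 E1 E2); rewrite -y0E //; apply: only12; rewrite y0E mem_head.
- by move=> _; apply: (no_far_jump_u2 E1 E2); rewrite -y0E //; apply: only12; rewrite y0E !inE eqxx orbT.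
- by move=> _; apply: (no_far_jump_u3 E1 E2); rewrite -y0E //; apply: only1; rewrite y0E !inE eqxx !orbT.
- by move=> _; apply: (no_far_jump_u4 E1 E2); rewrite -y0E //; apply: only2; rewrite y0E !inE eqxx !orbT.
- by move=> _; apply: (no_far_jump_P1 E1 E2 y0P1 w0); apply: only12; rewrite mem_cat y0P1 orbT.
- by move=> _; apply: (no_far_jump_A E1 E2 y0A w0).
case/or4P=> [->|->|->|/orP[y0B|y0Q]]; rewrite ?orbT // => _.
  exact: (no_far_jump_B E1 E2 y0B w0).
by apply: (no_far_jump_Q2 E1 E2 y0Q w0); apply: only2; rewrite !mem_cat y0Q !orbT.
Qed.

End FarJump.

(** * Jumps from z to a neighbour of zm or zp *)

Section NearJump.
Variable W : seq G.
Hypothesis iW : induced_path W.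
Hypothesis W0 : 0 < size W.
Hypothesis WU : {in W, forall w, w \notin U}.
Let n := last u1 W.
Hypothesis ev : adj z (head u1 W).

Let nU : n \notin U.
Proof. by apply: WU; apply: last_in_W. Qed.

Lemma near_jump nd sg k (Y : seq nat) :
    skeleton u1 nd sg -> skel_vertices nd sg =i U -> nth u1 nd 5 = z ->
    {in W, forall x, {in U, forall y, adj x y -> (x = head u1 W /\ y = z) \/ x = n}} ->
    {in U, forall y, adj n y -> y \in [seq nth u1 nd m | m <- k :: Y]} ->
  forall t sts, adj n (nth u1 nd t) -> model_path nd sg 5 t sts ->
    all (fun m => (m < size nd) && ((m == t) || (m \notin visited sg 5 sts))) (k :: Y) ->
    chordfree sg (visited sg 5 sts) sts ->
  2 * l + 1 <= size W + (model_length sg sts).+1 /\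
  (odd (size W + (model_length sg sts).+1) ->
   size W + (model_length sg sts).+1 = 2 * l + 1).
Proof.
move=> sk VU z5 att onY t sts wt mp YP cf.
apply: (@jump_from W iW W0 WU nd sg 5 (k :: Y) [::] sk VU _ _ t sts wt mp YP _ cf) => //.
  move=> x xW y yU xy; rewrite z5; case: (att x xW y yU xy) => [h|xn]; first by constructor 1.
  by constructor 2; split=> //; apply: onY => //; rewrite -xn.
by rewrite z5.
Qed.

(** By [e0] the path [W] has at least [2 * l - 1] vertices, so a hole through [W] and a longer route
    is too long to be odd, yet the routes of [e1] and [e2] have opposite parities. If [y2] is next
    to [u4], or [y1] next to [u1], the second route has a chord; then the cycle [g1] through [n],
    [zp], [z] and [u4] violates the girth. *)
Lemma near_jump_zp y :
    adj n zp ->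
    {in W, forall x, {in U, forall y, adj x y -> (x = head u1 W /\ y = z) \/ x = n}} ->
  y \in U -> adj n y -> y = zp.
Proof.
move=> np att yU ny; apply/eqP/negPn/negP => yp.
have [L1a [y1 [L1b [L2a [y2 [L2b [E1 E2 n1 n2]]]]]]] := neighbours_on_L1_L2 nU.
have s1 : size L1 = (size L1a + (size L1b).+1)%N by rewrite E1 size_cat.
have s2 : size L2 = (size L2a + (size L2b).+1)%N by rewrite E2 size_cat.
have [sk VU] := full_skeleton E1 E2.
have on : {in U, forall x, adj n x -> x \in [:: zp; y1; y2]}.
  move=> x xU nx; case/or3P: (U_split xU) => [x1|x2|xC].
  - by rewrite (n1 x x1 nx) !inE eqxx orbT.
  - by rewrite (n2 x x2 nx) !inE eqxx !orbT.
  - by rewrite (one_on C5 nU xC _ nx np) ?mem_head // !(mem_cat, inE) eqxx !orbT.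
have [w2|w2] := boolP (adj n y2).
  have J := @near_jump _ _ 6 [:: 7; 8] sk VU erefl att on.
  have on' : {in U, forall x, adj n x -> x \in [:: zp; y2] ++ [:: y1]}.
    by move=> x xU nx; have := on x xU nx; rewrite !inE => /or3P[]->; rewrite ?orbT.
  have Jn sts := @jump_at _ _ 6 8 sts _ [:: 7] sk VU nU on' np w2.
  jump_fact J full_labels 5 [:: 6] np e0.
  jump_fact J full_labels 5 [:: 4; 3; 8] w2 e1.
  jump_fact_if (0 < size L2a) J full_labels 5 [:: 4; 3; 0; 1; 8] w2 e2.
  jump_at_fact Jn full_labels 6 [:: 5; 4; 3; 8] g1.
  by clear J Jn; move: hl hL1 hL2 hP2 hp hAB s1 s2 e0 e1 e2 g1; clear; lia.
have on1 : {in U, forall x, adj n x -> x \in [:: zp; y1]}.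
  move=> x xU nx; have := on x xU nx; rewrite !inE => /or3P[->|->|/eqP xE]; rewrite ?orbT //.
  by rewrite -xE nx in w2.
have w1 : adj n y1.
  by have := on1 y yU ny; rewrite !inE (negbTE yp) => /eqP <-.
have J := @near_jump _ _ 6 [:: 7] sk VU erefl att on1.
have on' : {in U, forall x, adj n x -> x \in [:: zp; y1] ++ [::]} by rewrite cats0.
have Jn sts := @jump_at _ _ 6 7 sts _ [::] sk VU nU on' np w1.
jump_fact J full_labels 5 [:: 6] np e0.
jump_fact J full_labels 5 [:: 4; 3; 0; 7] w1 e1.
jump_fact_if (0 < size L1a) J full_labels 5 [:: 4; 3; 0; 1; 2; 7] w1 e2.
jump_fact_if (0 < size Q2) J full_labels 5 [:: 4; 3; 8; 1; 0; 7] w1 e3.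
jump_at_fact Jn full_labels 6 [:: 5; 4; 3; 0; 7] g1.
by clear J Jn; move: hl hL1 hL2 hP2 hp hAB s1 s2 e0 e1 e2 e3 g1; clear; lia.
Qed.

(** The mirror argument, with routes through [u3]; the arithmetic differs because [Q1] is a single
    edge while [Q2] may be long. *)
Lemma near_jump_zm y :
    adj n zm ->
    {in W, forall x, {in U, forall y, adj x y -> (x = head u1 W /\ y = z) \/ x = n}} ->
  y \in U -> adj n y -> y = zm.
Proof.
move=> nm att yU ny; apply/eqP/negPn/negP => ym.
have [L1a [y1 [L1b [L2a [y2 [L2b [E1 E2 n1 n2]]]]]]] := neighbours_on_L1_L2 nU.
have s1 : size L1 = (size L1a + (size L1b).+1)%N by rewrite E1 size_cat.
have s2 : size L2 = (size L2a + (size L2b).+1)%N by rewrite E2 size_cat.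
have [sk VU] := full_skeleton E1 E2.
have on : {in U, forall x, adj n x -> x \in [:: zm; y1; y2]}.
  move=> x xU nx; case/or3P: (U_split xU) => [x1|x2|xC].
  - by rewrite (n1 x x1 nx) !inE eqxx orbT.
  - by rewrite (n2 x x2 nx) !inE eqxx !orbT.
  - by rewrite (one_on C5 nU xC _ nx nm) ?mem_head // !(mem_cat, inE) eqxx !orbT.
have [w2|w2] := boolP (adj n y2).
  have J := @near_jump _ _ 4 [:: 7; 8] sk VU erefl att on.
  have on' : {in U, forall x, adj n x -> x \in [:: zm; y2] ++ [:: y1]}.
    by move=> x xU nx; have := on x xU nx; rewrite !inE => /or3P[]->; rewrite ?orbT.
  have Jn sts := @jump_at _ _ 4 8 sts _ [:: 7] sk VU nU on' nm w2.
  jump_fact J full_labels 5 [:: 4] nm e0.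
  jump_fact J full_labels 5 [:: 6; 2; 1; 8] w2 e1.
  jump_fact_if (0 < size L2b) J full_labels 5 [:: 6; 2; 1; 0; 3; 8] w2 e2.
  jump_at_fact Jn full_labels 4 [:: 5; 6; 2; 1; 8] g1.
  by clear J Jn; move: hl hL1 hL2 hP2 hp hAB s1 s2 e0 e1 e2 g1; clear; lia.
have on1 : {in U, forall x, adj n x -> x \in [:: zm; y1]}.
  move=> x xU nx; have := on x xU nx; rewrite !inE => /or3P[->|->|/eqP xE]; rewrite ?orbT //.
  by rewrite -xE nx in w2.
have w1 : adj n y1.
  by have := on1 y yU ny; rewrite !inE (negbTE ym) => /eqP <-.
have J := @near_jump _ _ 4 [:: 7] sk VU erefl att on1.
have on' : {in U, forall x, adj n x -> x \in [:: zm; y1] ++ [::]} by rewrite cats0.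
have Jn sts := @jump_at _ _ 4 7 sts _ [::] sk VU nU on' nm w1.
jump_fact J full_labels 5 [:: 4] nm e0.
jump_fact J full_labels 5 [:: 6; 2; 7] w1 e1.
jump_fact_if (0 < size L1b) J full_labels 5 [:: 6; 2; 1; 0; 7] w1 e2.
jump_at_fact Jn full_labels 4 [:: 5; 6; 2; 7] g1.
by clear J Jn; move: hl hL1 hL2 hP2 hp hAB s1 s2 e0 e1 e2 g1; clear; lia.
Qed.

End NearJump.

(* Rerouting the odd cycle through [Q2], [P1] and the even cycle through [L2]
   gives holes of different parities. *)
Lemma no_jump_zm_zp (W : seq G) :
    induced_path W -> 0 < size W -> {in W, forall w, w \notin U} ->
    adj zm (head u1 W) -> adj (last u1 W) zp ->
    {in W, forall x, {in U, forall y, adj x y ->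
      [\/ x = head u1 W /\ y = zm, x = last u1 W /\ y = zp | y = z]}} -> False.
Proof.
move=> iW W0 WU em ep att.
have L1_gt0 : 0 < size L1 by move: hL1 hP2 hp; clear; lia.
have L2_gt0 : 0 < size L2 by move: hL2 hP2 hp; clear; lia.
have att' : {in W, forall x, {in U, forall y, adj x y ->
    [\/ x = head u1 W /\ y = zm, x = last u1 W /\ y \in [:: zp] | y \in [:: z]]}}.
  move=> x xW y yU xy; case: (att x xW y yU xy) => [h|[xl ->]|->].
  - by constructor 1.
  - by constructor 2; rewrite mem_head.
  - by constructor 3; rewrite mem_head.
have J := @jump_from W iW W0 WU _ _ 4 [:: 6] [:: 5] sk7 (fun=> erefl) att' em 6.
have := J [:: (3, false); (2, false); (0, true); (1, true); (6, false)] ep isT isT isT.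
rewrite {1}/chordfree /= L1_gt0 L2_gt0 /= => /(_ isT) e1.
have e2 := J [:: (3, false); (8, true); (1, true); (6, false)] ep isT isT isT isT.
rewrite /model_length /= in e1 e2.
(* The two holes have [2 * l + size W] and [2 * p + 1 + size W] vertices, p being the length of P2.
   As p >= l, the odd one of them is too long, unless [size W = 1]; but a single vertex would have
   two neighbours on P1 Q1 P2 Q2. *)
have W1 : size W != 1.
  apply/eqP; case: (W) em ep WU => [|x [|? ?]] //= zmx xzp WU1 _.
  have mp : zm = zp.
    apply: (one_on C5 (WU1 x (mem_head _ _))); rewrite // 1?adj_sym //.
      by rewrite !(mem_cat, inE) eqxx !orbT.
    by rewrite !(mem_cat, inE) eqxx !orbT.
  by have := @node_inj _ _ _ _ sk7 4 6 isT isT mp.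
clear J; move: hl hL1 hL2 hP2 hp W1 W0 e1 e2; clear; lia.
Qed.

Lemma no_triangle (x y t : G) : adj x y -> adj y t -> adj x t -> False.
Proof.
move=> xy yt xt; have /girth_ge : is_cycle [:: x; y; t].
  have ne (a b : G) : adj a b -> a != b.
    by move=> ab; apply: contraTneq ab => ->; rewrite adj_irrefl.
  by rewrite /is_cycle /= !inE !negb_or xy yt (adj_sym t) xt !ne.
by move: hl; rewrite /=; clear; lia.
Qed.

Lemma z_neighbours x : x \in U -> adj z x -> x \in [:: zm; zp].
Proof.
move=> xU zx; case: (sk7) => _ _ _ edges.
have zU : z \in U by rewrite mem_cat !inE eqxx !orbT.
have /hasP[s sin e] := edges z x zU xU zx.
have lk : index s window_segments < 9 by rewrite index_mem.
have sE : s = seg_at window_segments (index s window_segments) by rewrite /seg_at nth_index.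
move: (index _ _) lk sE => k lk sE; rewrite {}sE in e.
have zs : z \in seg_vertices u1 window_nodes (seg_at window_segments k).
  by case/orP: e => /infixP[t1 [t2 ->]]; rewrite !mem_cat !inE eqxx ?orbT.
have [la lb] := seg_ends sk7 lk.
have lab : ((seg_at window_segments k).1.1 == 5) || ((seg_at window_segments k).1.2 == 5).
  move: zs; rewrite inE mem_rcons inE => /or3P[/eqP zE|/eqP zE|zb].
  - by rewrite (@node_inj _ _ _ _ sk7 _ 5 la isT (esym zE)).
  - by rewrite (@node_inj _ _ _ _ sk7 _ 5 lb isT (esym zE)) orbT.
  - by have := @body_not_node _ _ _ _ sk7 k 5 lk isT; rewrite zb.
have mem2 (a b c d : G) : on_path_edge [:: a; b] c d -> d \in [:: a; b].
  by case/orP=> /infixP[t1 [t2 ->]]; rewrite !mem_cat !inE eqxx ?orbT.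
have zx' : x != z by apply: contraTneq zx => ->; rewrite adj_irrefl.
have : (k == 4) || (k == 5).
  by move: lk lab; clear; case: k => [|[|[|[|[|[|[|[|[|]]]]]]]]].
case/orP=> /eqP kE; rewrite kE in e; have := mem2 _ _ _ _ e.
  by rewrite !inE (negbTE zx') orbF => ->.
by rewrite !inE (negbTE zx') /= => ->; rewrite orbT.
Qed.

(** * The component F and its star cutset *)

Lemma window_impossible : vertex_critical4 G -> False.
Proof.
move=> crit; have [w1 [zw1 w1m w1p]] := critical_third_neighbour z zm zp crit.
have zmz : adj zm z.
  case: (sk7) => _ _ /allP ps _.
  by have := ps _ (@seg_at_in _ window_segments 4 isT); rewrite /= andbT.
have zzp : adj z zp.
  case: (sk7) => _ _ /allP ps _.
  by have := ps _ (@seg_at_in _ window_segments 5 isT); rewrite /= andbT.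
have inU x : x \in window_nodes -> x \in U by rewrite mem_cat => ->.
have w1U : w1 \notin U.
  by apply/negP=> /z_neighbours/(_ zw1); rewrite !inE (negbTE w1m) (negbTE w1p).
pose D v := [&& v \notin U, ~~ adj zm v & ~~ adj zp v].
have Dw1 : D w1.
  apply/and3P; split=> //; apply/negP=> e; first exact: no_triangle zmz zw1 e.
  by apply: no_triangle zzp _ zw1.
pose e := [rel x y : G | [&& adj x y, D x & D y]].
have es : connect_sym e.
  by apply: sym_connect_sym => x y /=; rewrite adj_sym (andbC (D x)).
pose F := connect e w1.
have FD v : F v -> D v.
  case/connectP=> p; elim/last_ind: p => [_ ->//|p x _].
  by rewrite rcons_path last_rcons => /andP[_ /and3P[_ _ Dx]] ->.
have path_e x p : path e x p -> path (@adj G) x p.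
  by apply: sub_path => a b /and3P[].
have Fpath p : path e w1 p -> all F (w1 :: p).
  by move=> pe; apply/allP=> v; apply: path_connect.
have claim1 f x : F f -> x \in U -> adj f x -> x = z.
  case/connectP=> p pe fE xU fx; apply/eqP/negPn/negP=> xz.
  have [|||||W [W0 iW FW [AW AW'] [BW BW']]] := @shortest_link G F (adj z)
    (fun v => has (fun y => adj v y && (y != z)) U) u1 (w1 :: p).
  - by [].
  - exact: path_e.
  - exact: Fpath.
  - by [].
  - have : has (fun y => adj f y && (y != z)) U by apply/hasP; exists x; rewrite ?fx.
    by rewrite fE.
  have [y yU /andP[wy yz]] := hasP BW.
  have WD v : v \in W -> D v by move=> /(allP FW)/FD.
  have nwin v y' : v \in W -> adj v y' -> y' != z -> y' \notin [:: zm; z; zp].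
    move=> /WD/and3P[_ nm np] vy' y'z; rewrite !inE !negb_or y'z /=; apply/andP; split.
      by apply: contraNneq nm => <-; rewrite adj_sym.
    by apply: contraNneq np => <-; rewrite adj_sym.
  apply: (no_far_jump iW W0 _ AW _ yU wy).
  - by move=> v /WD/and3P[].
  - move=> v vW y' y'U vy'; have [y'z|y'z] := eqVneq y' z.
      by left; split=> //; apply: AW' => //; rewrite -y'z adj_sym.
    right; split; last exact: nwin vW vy' y'z.
    by apply: BW' => //; apply/hasP; exists y'; rewrite ?vy'.
  - exact: nwin (last_in_W W0) wy yz.
have link n f : F f -> adj n f -> n \notin U ->
    exists W, [/\ 0 < size W, induced_path W, all (fun v => F v || (v == n)) W,
      adj z (head u1 W) /\ {in W, forall x, adj z x -> x = head u1 W} & last u1 W = n].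
  case/connectP=> p pe fE nf nU.
  have [|||||W [W0 iW FW AW [/eqP BW _]]] := @shortest_link G (fun v => F v || (v == n)) (adj z)
    (pred1 n) u1 (w1 :: rcons p n).
  - by [].
  - by rewrite /= rcons_path path_e //= -fE adj_sym.
  - rewrite /= all_rcons eqxx orbT /=; have /andP[Fw1 Fp] := Fpath _ pe.
    by rewrite Fw1; apply: sub_all Fp => v ->.
  - by [].
  - by rewrite /= last_rcons.
  by exists W.
(* Such an [n] is outside [F], so [claim1] says nothing about it. Its other neighbours in H have to
   be excluded before it can serve as an end of the path that replaces [z]. *)
have claim2p n f y : F f -> adj n f -> n \notin U -> adj n zp -> y \in U -> adj n y -> y = zp.
  move=> Ff nf nU np yU ny; have [W [W0 iW FW [AW AW'] lW]] := link n f Ff nf nU.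
  apply: (near_jump_zp iW W0 _ AW _ _ yU); rewrite ?lW //.
    by move=> v /(allP FW)/orP[/FD/and3P[]|/eqP->].
  move=> v vW y' y'U vy'; case/orP: (allP FW v vW) => [Fv|/eqP]; last by right.
  left; have y'z := claim1 _ _ Fv y'U vy'; split=> //.
  by apply: AW' => //; rewrite -y'z adj_sym.
have claim2m n f y : F f -> adj n f -> n \notin U -> adj n zm -> y \in U -> adj n y -> y = zm.
  move=> Ff nf nU np yU ny; have [W [W0 iW FW [AW AW'] lW]] := link n f Ff nf nU.
  apply: (near_jump_zm iW W0 _ AW _ _ yU); rewrite ?lW //.
    by move=> v /(allP FW)/orP[/FD/and3P[]|/eqP->].
  move=> v vW y' y'U vy'; case/orP: (allP FW v vW) => [Fv|/eqP]; last by right.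
  left; have y'z := claim1 _ _ Fv y'U vy'; split=> //.
  by apply: AW' => //; rewrite -y'z adj_sym.
have claim3 n f n' f' : F f -> adj n f -> n \notin U -> adj n zp ->
    F f' -> adj n' f' -> n' \notin U -> adj n' zm -> False.
  move=> Ff nf nU np Ff' nf' nU' nm'.
  have /connectP[p pe fE] : connect e f' f by rewrite (connect_trans _ Ff) // es.
  pose D' v := [|| F v, v == n | v == n'].
  have [|||||W [W0 iW DW [AW AW'] [BW BW']]] := @shortest_link G D' (adj zm)
    (fun v => adj v zp) u1 (n' :: f' :: rcons p n).
  - by [].
  - by rewrite /= nf' rcons_path path_e //= -fE adj_sym.
  - rewrite /= all_rcons /D' !eqxx !orbT Ff' /=; apply/allP=> v vp; apply/orP; left.
    by apply: connect_trans Ff' _; apply: (path_connect pe); rewrite inE vp orbT.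
  - by rewrite /= adj_sym.
  - by rewrite /= last_rcons.
  apply: (no_jump_zm_zp iW W0 _ AW BW).
    by move=> v /(allP DW)/or3P[/FD/and3P[]|/eqP->|/eqP->].
  move=> v vW y yU vy; case/or3P: (allP DW v vW) => [Fv|/eqP vE|/eqP vE].
  - by constructor 3; apply: claim1 Fv yU vy.
  - constructor 2; rewrite vE in vy *; have yp := claim2p n f y Ff nf nU np yU vy.
    by split=> //; apply: BW'; rewrite -?vE // vE.
  - constructor 1; rewrite vE in vy *; have ym := claim2m n' f' y Ff' nf' nU' nm' yU vy.
    by split=> //; apply: AW'; rewrite -?vE // vE adj_sym.
have nzz : ~~ adj zm zp by apply/negP=> h; apply: no_triangle zmz zzp h.
have FU v : F v -> v \notin U by case/FD/and3P.
have hl2 : 2 <= l by apply: leq_trans hl.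
have Fw1 : F w1 by apply: connect0.
have ext f v : F f -> adj f v -> v \notin U -> [|| F v, adj zm v | adj zp v].
  move=> Ff fv vU; have [|nm] := boolP (adj zm v); first by rewrite orbT.
  have [|np] := boolP (adj zp v); first by rewrite !orbT.
  suff -> : F v by [].
  apply: (connect_trans Ff); apply: connect1; rewrite /= fv (FD f Ff) /=.
  by apply/and3P; split.
(* The only neighbour of [F] in H is [z], which is adjacent to either centre. The vertex [r]
   witnesses that something lies beyond the star; the other one of [zm] and [zp] will do, since they
   are not adjacent. *)
have cut x r : x \in [:: zm; zp] -> r \in window_nodes -> r != x -> ~~ adj x r ->
    (forall f v, F f -> adj f v -> v \notin U -> F v || adj x v) -> False.
  move=> xz rU rx xr out.
  apply: (no_star_cutset hl2 girth_ge hodd (F := F) crit Fw1 _ rx xr).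
  - by apply/negP=> /FU; rewrite inU.
  - move=> v Fv; apply/andP; split.
      apply: contraNneq (FU v Fv) => ->; apply: inU.
      by move: xz; rewrite !inE => /orP[]->; rewrite ?orbT.
    by case/and3P: (FD v Fv) => _; move: xz; rewrite !inE => /orP[] /eqP->.
  - move=> f v Ff fv; have [vU|vU] := boolP (v \in U).
      rewrite (claim1 f v Ff vU fv); apply/or3P; constructor 3.
      by move: xz; rewrite !inE => /orP[] /eqP->; rewrite // adj_sym.
    by case/orP: (out f v Ff fv vU) => ->; rewrite ?orbT.
have neq : zm != zp by apply/eqP=> mp; have := @node_inj _ _ _ _ sk7 4 6 isT isT mp.
have [/existsP[n' /andP[/andP[nU' nm'] /existsP[f' /andP[Ff' nf']]]]|/existsPn no] :=
  boolP [exists n, ((n \notin U) && adj n zm) && [exists f, F f && adj n f]].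
  apply: (cut zm zp); rewrite ?inE ?eqxx ?orbT //; first by rewrite eq_sym.
  move=> f v Ff fv vU; case/or3P: (ext f v Ff fv vU) => [->|->|zpv]; rewrite ?orbT //.
  by case: (claim3 v f n' f'); rewrite // adj_sym.
apply: (cut zp zm); rewrite ?inE ?eqxx ?orbT //; first by rewrite adj_sym.
move=> f v Ff fv vU; case/or3P: (ext f v Ff fv vU) => [->|zmv|->]; rewrite ?orbT //.
have := no v; rewrite vU adj_sym zmv /= => /existsPn/(_ f).
by rewrite Ff adj_sym fv.
Qed.

End Window.

(** * The middle of P2 and the conclusion *)

Lemma split_middle (T : Type) (s : seq T) : 4 <= size s ->
  exists A a b c B, s = A ++ [:: a, b, c & B] /\ size A <= size B <= size A + 1.
Proof.
(* The value of [k] is half of [size s - 3], rounded down: the three middle vertices are set aside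
   and any surplus vertex goes to [B]. *)
move=> s4; pose k := (size s).+1./2 - 2.
have sE := cat_take_drop k s; have sd := size_drop k s.
have st : size (take k s) = k by rewrite size_takel // /k; clear -s4; lia.
case: (drop k s) sE sd => [|a [|b [|c B]]] sE /= sd; try by move: sd s4; rewrite /k; clear; lia.
exists (take k s), a, b, c, B; rewrite st; split=> //.
by move: sd s4; rewrite /k; clear; lia.
Qed.

Lemma window_skeleton (G : sgraph) (u1 u2 u3 u4 zm z zp : G) (P1 Q2 A B L1 L2 : seq G) :
    skeleton u1 (k4_nodes u1 u2 u3 u4)
      (k4_segments P1 [::] Q2 (A ++ [:: zm, z, zp & B]) L1 L2) ->
  skeleton u1 (window_nodes u1 u2 u3 u4 zm z zp) (window_segments P1 Q2 A B L1 L2) /\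
  skel_vertices (k4_nodes u1 u2 u3 u4)
    (k4_segments P1 [::] Q2 (A ++ [:: zm, z, zp & B]) L1 L2) =i
  skel_vertices (window_nodes u1 u2 u3 u4 zm z zp) (window_segments P1 Q2 A B L1 L2).
Proof.
set s0 := [:: (0, 1, P1); (1, 2, [::]); (0, 3, Q2)]; set e0 := [:: (0, 2, L1); (3, 1, L2)].
set n4 := k4_nodes _ _ _ _ => sk.
have sk5 := @skeleton_subdivide _ _ n4 s0 3 2 A zm [:: z, zp & B] e0 sk.
have sk6 := @skeleton_subdivide _ _ (rcons n4 zm) (s0 ++ [:: (3, 4, A)]) 4 2 [::] z (zp :: B) e0 sk5.
have sk7 := @skeleton_subdivide _ _ (rcons (rcons n4 zm) z)
  (s0 ++ [:: (3, 4, A); (4, 5, [::])]) 5 2 [::] zp B e0 sk6.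
split=> // x.
have := perm_mem (@skel_vertices_subdivide _ n4 s0 3 2 A zm [:: z, zp & B] e0) x.
have := perm_mem (@skel_vertices_subdivide _ (rcons n4 zm) (s0 ++ [:: (3, 4, A)]) 4 2 [::] z
  (zp :: B) e0) x.
have := perm_mem (@skel_vertices_subdivide _ (rcons (rcons n4 zm) z)
  (s0 ++ [:: (3, 4, A); (4, 5, [::])]) 5 2 [::] zp B e0) x.
by move=> h1 h2 h3; rewrite -[LHS]h3 -[LHS]h2 -[LHS]h1.
Qed.

Theorem theorem3p2 (l : nat) (hl : 5 <= l) (G : sgraph)
  (hgirth : has_girth G (2 * l + 1))
  (hodd : forall c : seq G, odd_hole c -> ~~ (2 * l + 3 <= size c))
  (hcrit : vertex_critical4 G) :
  ~ contains_balanced_K4_subdivision_12 G.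
Proof.
case: hgirth => _ girth_ge.
case/balanced_K4_skeleton=> u1 [u2 [u3 [u4 [P1 [Q2 [P2 [L1 [L2 [sk o1 o2 e3 L20]]]]]]]]].
have [[hL1 hL2 hP2 hp] [C1 C2 C5]] := balanced_lengths hl girth_ge hodd sk o1 o2 e3 L20.
(* With [l >= 5], the bound [l <= size P2 + 1] provides the four interior vertices of P2 that the
   splitting asks for. *)
have [A [zm [z [zp [B [P2E hAB]]]]]] : exists A a b c B,
    P2 = A ++ [:: a, b, c & B] /\ size A <= size B <= size A + 1.
  by apply: split_middle; move: hp hl; clear; lia.
rewrite P2E size_cat /= in sk hP2 hp C1 C2 C5.
have [sk7 VU] := window_skeleton sk.
have C s : short_cycle l (skel_vertices (k4_nodes u1 u2 u3 u4)
      (k4_segments P1 [::] Q2 (A ++ [:: zm, z, zp & B]) L1 L2)) s ->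
    short_cycle l (skel_vertices (window_nodes u1 u2 u3 u4 zm z zp)
      (window_segments P1 Q2 A B L1 L2)) s.
  by case=> c [cyc sc cU cs]; exists c; split=> // x /cU; rewrite VU.
apply: (window_impossible hl girth_ge hodd sk7 hL1 hL2 _ _ hAB (C _ C1) (C _ C2) (C _ C5) hcrit).
  by move: hP2; clear; lia.
by move: hp; clear; lia.
Qed.
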